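(* Let $\Psi\in C_c^\infty(0,\infty)$. Let either $j\in\{1,2\}$ and $k\in\mathbb{Z}$, or $j\in\{3,4\}$ and $k\in\mathbb{Z}\setminus\{0\}$. Then there is a constant $c$, depending on $\Psi$ and on the fixed $j$ and $k$ but not on $t$ or $v$, such that $$\left\|\exp\left(-\mathrm{i}t\lambda_j(\sqrt{-\Delta_h},k)\right)\Psi(\sqrt{-\Delta_h})[v]\right\|_{L^\infty(\mathbb{R}^2)}\le c\,|t|^{-1/2}\left\|\Psi(\sqrt{-\Delta_h})[v]\right\|_{L^1(\mathbb{R}^2)}$$ for all $t\in\mathbb{R}\setminus\{0\}$ and all $v\in L^2(\mathbb{R}^2)$ with $\Psi(\sqrt{-\Delta_h})[v]\in L^1(\mathbb{R}^2)$.
   Context: For $\xi\in\mathbb{R}^2$ and $k\in\mathbb{Z}$ the functions $\lambda_j(\xi,k)=\lambda_j(|\xi|,k)$ are $$\lambda_1=\left[\frac{1+|\xi|^2+k^2+\sqrt{(1+|\xi|^2+k^2)^2-4k^2}}{2}\right]^{1/2},\quad \lambda_2=-\lambda_1,$$ $$\lambda_3=\left[\frac{1+|\xi|^2+k^2-\sqrt{(1+|\xi|^2+k^2)^2-4k^2}}{2}\right]^{1/2},\quad \lambda_4=-\lambda_3 .$$ They are the eigenvalues of the Hermitian matrix $$\mathcal A(\xi,k)=\begin{pmatrix}0&\xi_1&\xi_2&k\\ \xi_1&0&\mathrm i&0\\ \xi_2&-\mathrm i&0&0\\ k&0&0&0\end{pmatrix},$$ which is the Fourier symbol of the acoustic–Rossby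 wave system $\varepsilon\partial_ts+\mathrm{div}_x\mathbf V=0$, $\varepsilon\partial_t\mathbf V+\boldsymbol\omega\times\mathbf V+\nabla_xs=0$, $\boldsymbol\omega=[0,0,1]$. For a function $m$ on $(0,\infty)$, the operator $m(\sqrt{-\Delta_h})$ is the Fourier multiplier on $\mathbb{R}^2$ given by $m(\sqrt{-\Delta_h})[v]=\mathcal F^{-1}_{\xi\to x_h}[m(|\xi|)\hat v(\xi)]$; this applies to $\Psi(\sqrt{-\Delta_h})$ and, with $m(|\xi|)=\exp(-\mathrm it\lambda_j(|\xi|,k))$, to $\exp(-\mathrm{i}t\lambda_j(\sqrt{-\Delta_h},k))$. *)

(* Defs.v *)
From HB Require Import structures.
From mathcomp Require Import all_boot all_order all_algebra.
From mathcomp Require Import all_classical all_reals all_analysis.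
From mathcomp Require Export complex.
Set Implicit Arguments.
Unset Strict Implicit.
Unset Printing Implicit Defensive.
Import Order.TTheory GRing.Theory Num.Theory.
Import numFieldNormedType.Exports.

Local Open Scope classical_set_scope.
Local Open Scope ring_scope.
Local Open Scope complex_scope.

Definition leb2 (R : realType) :
    {measure set (measurableTypeR R * measurableTypeR R) -> \bar R} :=
  (@lebesgue_measure R \x @lebesgue_measure R)%E.

Definition dot2 (R : realType) (x y : R * R) : R := x.1 * y.1 + x.2 * y.2.

(* The norm carried by the product type [R * R] is the sup norm, hence this
   definition. *)
Definition norm2 (R : realType) (x : R * R) : R :=
  Num.sqrt (x.1 ^+ 2 + x.2 ^+ 2).

Definition expi (R : realType) (a : R) : R[i] := cos a +i* sin a.

Definition cmeasurable (R : realType) (f : R * R -> R[i]) : Prop :=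
  measurable_fun [set: measurableTypeR R * measurableTypeR R]
    (fun x => complex.Re (f x)) /\
  measurable_fun [set: measurableTypeR R * measurableTypeR R]
    (fun x => complex.Im (f x)).

Definition cintegral (R : realType) (f : R * R -> R[i]) : R[i] :=
  (\int[leb2 R]_x complex.Re (f x)) +i* (\int[leb2 R]_x complex.Im (f x)).

Definition cLnorm (R : realType) (p : \bar R) (f : R * R -> R[i]) : \bar R :=
  Lnorm (leb2 R) p (fun x => (Normc.normc (f x))%:E).

Definition inL (R : realType) (p : \bar R) (f : R * R -> R[i]) : Prop :=
  cmeasurable f /\ (cLnorm p f < +oo)%E.

(* Restriction to a disc: it sends L^2 into the intersection of L^1 and L^2,
   where the integrals defining the Fourier transform converge. *)
Definition truncate (R : realType) (n : nat) (f : R * R -> R[i]) :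
    R * R -> R[i] :=
  fun x => if norm2 x <= n%:R then f x else 0.

Definition fourier1 (R : realType) (f : R * R -> R[i]) : R * R -> R[i] :=
  fun xi => cintegral (fun x => expi (- dot2 x xi) * f x).

Definition inv_fourier1 (R : realType) (g : R * R -> R[i]) : R * R -> R[i] :=
  fun x => (((2 * pi) ^- 2 : R)%:C) *
           cintegral (fun xi => expi (dot2 x xi) * g xi).

(* [is_fourier f g]: g is (a representative of) the Fourier--Plancherel
   transform of f in L^2, i.e. the limit in L^2 of the integrals over discs of
   radius n. *)
Definition is_fourier (R : realType) (f g : R * R -> R[i]) : Prop :=
  [/\ inL 2%:E f, inL 2%:E g &
      (fun n : nat => cLnorm 2%:E (fun xi => fourier1 (truncate n f) xi - g xi))
        @ \oo --> 0%E].

Definition is_inv_fourier (R : realType) (g f : R * R -> R[i]) : Prop :=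
  [/\ inL 2%:E g, inL 2%:E f &
      (fun n : nat => cLnorm 2%:E (fun x => inv_fourier1 (truncate n g) x - f x))
        @ \oo --> 0%E].

(* [is_multiplier m v w]: w is (a representative of) m(sqrt(-Delta_h))[v]. The
   value of m at 0 only matters at the single frequency xi = 0. *)
Definition is_multiplier (R : realType) (m : R -> R[i])
    (v w : R * R -> R[i]) : Prop :=
  exists2 vhat : R * R -> R[i], is_fourier v vhat &
    is_inv_fourier (fun xi => m (norm2 xi) * vhat xi) w.

(* Complex-valued C_c^oo(0, +oo), each function being extended by 0 to the
   whole line. *)
Definition smooth (R : realType) (f : R -> R) : Prop :=
  forall (n : nat) (x : R), derivable (derive1n n f) x 1.

Definition Cc_smooth_pos (R : realType) (Psi : R -> R[i]) : Prop :=
  [/\ smooth (fun r => complex.Re (Psi r)),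
      smooth (fun r => complex.Im (Psi r)),
      compact (closure [set r | Psi r != 0]) &
      closure [set r | Psi r != 0] `<=` [set r | 0 < r]].

Definition lambda1 (R : realType) (r : R) (k : int) : R :=
  let b : R := 1 + r ^+ 2 + k%:~R ^+ 2 in
  Num.sqrt ((b + Num.sqrt (b ^+ 2 - 4 * k%:~R ^+ 2)) / 2).

Definition lambda3 (R : realType) (r : R) (k : int) : R :=
  let b : R := 1 + r ^+ 2 + k%:~R ^+ 2 in
  Num.sqrt ((b - Num.sqrt (b ^+ 2 - 4 * k%:~R ^+ 2)) / 2).

(* Only j = 1, 2, 3, 4 are meaningful. *)
Definition lambda (R : realType) (j : nat) (r : R) (k : int) : R :=
  match j with
  | 1 => lambda1 r k
  | 2 => - lambda1 r k
  | 3 => lambda3 r k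
  | 4 => - lambda3 r k
  | _ => 0
  end.

(* Main.v *)
Require Import Defs.
From HB Require Import structures.
From mathcomp Require Import all_boot all_order all_algebra.
From mathcomp Require Import all_classical all_reals all_analysis.
From mathcomp Require Import measurable_realfun ess_sup_inf ring lra.
Set Implicit Arguments.
Unset Strict Implicit.
Unset Printing Implicit Defensive.
Import Order.TTheory GRing.Theory Num.Theory.
Import numFieldNormedType.Exports.
Local Open Scope classical_set_scope.
Local Open Scope ring_scope.
Local Open Scope complex_scope.

(* The function w = Psi(sqrt(-Delta))[v] is the inverse transform of an
   integrable function supported in an annulus. Wide bump functions show that
   the transform of w vanishes off a neighbourhood of that annulus, so a radial
   cutoff chi can be inserted, and u is the convolution of w with the kernel
   K_t(z) = (2 pi)^-2 int exp(i (z.xi - t lambda(|xi|))) chi(|xi|^2) d xi.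
   It remains to bound K_t by C |t|^(-1/2) uniformly in z.

   With X = sqrt(|xi|^2 + (|k|+1)^2) and Y = sqrt(|xi|^2 + (|k|-1)^2) one has
   lambda_1 = (X + Y)/2 and lambda_3 = (X - Y)/2, so lambda is a smooth function
   of |xi|^2 > 0 without critical points. No second-order nondegeneracy is
   needed: writing phi for the phase and D = |t| + |grad phi|^2,
     cos(phi) chi = cos(phi) chi |t| / D + grad(sin(phi)) . grad(phi) chi / D,
   and an integration by parts reduces everything to the integral of |t| / D over
   the annulus. If |z| is small compared with |t| the gradient is at least of
   order |t|; otherwise its component along xi^perp, which does not involve
   lambda, is linear in xi and |t| / D is dominated by the derivative of an
   arctangent in one of the two variables. *)

(** The choice of D makes a single integration by parts sufficient. On the annulus the Hessian of
    the phase is O(|t|), so differentiating grad(phi) / D costs only |t| / D again; the terms where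
    the derivative falls on chi are O(|t|^(-1/2)), because D >= 2 |t|^(1/2) |grad phi|. The exponent
    1/2 comes from the set where |grad phi| <= |t|^(1/2): if |z| is at least of order |t|, the
    component along xi^perp confines it to a strip of width O(|t|^(1/2) / |z|). On the Fourier side
    w is given only through L^2 limits. Full inversion is avoided: inserting chi requires the
    transform of w to vanish wherever chi differs from 1, not to be identified with Psi times the
    transform of v. The multiplication formula (int f F[g] = int g F[f]) does two jobs: it moves the
    transform onto the bumps, which gives the vanishing, and it turns u into an integral of w
    against the kernel. *)

Local Notation Re := complex.Re.
Local Notation Im := complex.Im.
Local Notation normc := Normc.normc.

(** * Complex integrals *)

Section complex_norm.
Context {R : rcfType}.
Implicit Types z w : R[i].

Lemma Re_mulc z w : Re (z * w) = Re z * Re w - Im z * Im w.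
Proof. by case: z w => [a b] [c d]. Qed.

Lemma Im_mulc z w : Im (z * w) = Re z * Im w + Im z * Re w.
Proof. by case: z w => [a b] [c d]. Qed.

Lemma Re_subc z w : Re (z - w) = Re z - Re w.
Proof. by case: z w => [a b] [c d]. Qed.

Lemma Im_subc z w : Im (z - w) = Im z - Im w.
Proof. by case: z w => [a b] [c d]. Qed.

Lemma normcE z : normc z = Num.sqrt (Re z ^+ 2 + Im z ^+ 2).
Proof. by case: z. Qed.

Lemma normc_ge0 z : 0 <= normc z.
Proof. by rewrite normcE sqrtr_ge0. Qed.

Lemma sqr_normcE z : normc z ^+ 2 = Re z ^+ 2 + Im z ^+ 2.
Proof. by rewrite normcE sqr_sqrtr// addr_ge0 ?sqr_ge0. Qed.

Lemma Re_le_normc z : `|Re z| <= normc z.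
Proof. by rewrite normcE -sqrtr_sqr ler_wsqrtr// lerDl sqr_ge0. Qed.

Lemma Im_le_normc z : `|Im z| <= normc z.
Proof. by rewrite normcE -sqrtr_sqr ler_wsqrtr// lerDr sqr_ge0. Qed.

Lemma normc_le_ReIm z : normc z <= `|Re z| + `|Im z|.
Proof.
rewrite -ler_sqr ?nnegrE ?addr_ge0 ?normc_ge0// sqr_normcE.
by rewrite sqrrD !real_normK ?num_real// lerD2r lerDl mulrn_wge0 ?mulr_ge0.
Qed.

End complex_norm.

Lemma normc_expi (R : realType) (a : R) : normc (expi a) = 1.
Proof. by rewrite normcE /= cos2Dsin2 sqrtr1. Qed.

Section complex_integral.
Context d (T : measurableType d) (R : realType).
Variable mu : {measure set T -> \bar R}.
Implicit Types (f g : T -> R[i]) (h k : T -> R).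

Definition cmeas f := measurable_fun setT (fun x => Re (f x)) /\
  measurable_fun setT (fun x => Im (f x)).

Definition cint f : R[i] := (\int[mu]_x Re (f x)) +i* (\int[mu]_x Im (f x)).

Definition rintegrable h := mu.-integrable setT (fun x => (h x)%:E).

Definition cintegrable f :=
  rintegrable (fun x => Re (f x)) /\ rintegrable (fun x => Im (f x)).

Lemma cmeasM f g : cmeas f -> cmeas g -> cmeas (fun x => f x * g x).
Proof.
move=> [f1 f2] [g1 g2]; split.
  under eq_fun do rewrite Re_mulc.
  by apply: measurable_funB; exact: measurable_funM.
under eq_fun do rewrite Im_mulc.
by apply: measurable_funD; exact: measurable_funM.
Qed.

Lemma cmeasB f g : cmeas f -> cmeas g -> cmeas (fun x => f x - g x).
Proof.
move=> [f1 f2] [g1 g2]; split.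
  by under eq_fun do rewrite Re_subc; apply: measurable_funB.
by under eq_fun do rewrite Im_subc; apply: measurable_funB.
Qed.

Lemma cmeas_real h : measurable_fun setT h -> cmeas (fun x => (h x)%:C).
Proof. by move=> mh; split => //=; exact: measurable_cst. Qed.

Lemma cmeas_cst c : cmeas (fun=> c).
Proof. by split; exact: measurable_cst. Qed.

Lemma cmeas_expi h : measurable_fun setT h -> cmeas (fun x => expi (h x)).
Proof.
move=> mh; split => /=; apply: measurableT_comp => //.
  by apply: continuous_measurable_fun; exact: continuous_cos.
by apply: continuous_measurable_fun; exact: continuous_sin.
Qed.

Lemma measurable_normc f : cmeas f ->
  measurable_fun setT (fun x => normc (f x)).
Proof.
move=> [f1 f2]; under eq_fun do rewrite normcE.
apply: measurableT_comp.
  by apply: continuous_measurable_fun; exact: sqrt_continuous.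
by apply: measurable_funD; exact: measurable_funX.
Qed.

Lemma rintegrable_measurable h : rintegrable h -> measurable_fun setT h.
Proof. by move=> /measurable_int/measurable_EFinP. Qed.

Lemma cintegrable_cmeas f : cintegrable f -> cmeas f.
Proof. by move=> [/rintegrable_measurable + /rintegrable_measurable]. Qed.

Lemma le_rintegrable h k : measurable_fun setT h ->
  (forall x, `|h x| <= k x) -> rintegrable k -> rintegrable h.
Proof.
move=> mh hk; apply: le_integrable => //; first exact/measurable_EFinP.
by move=> x _ /=; rewrite lee_fin (le_trans (hk x))// ler_norm.
Qed.

Lemma le_cintegrable f k : cmeas f ->
  (forall x, normc (f x) <= k x) -> rintegrable k -> cintegrable f.
Proof.
move=> [f1 f2] fk ik; split; apply: le_rintegrable ik => // x;
  rewrite (le_trans _ (fk x))//; [exact: Re_le_normc|exact: Im_le_normc].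
Qed.

Lemma rintegrableD h k : rintegrable h -> rintegrable k ->
  rintegrable (fun x => h x + k x).
Proof. by move=> ih ik; exact: (@integrableD _ _ _ mu setT measurableT _ _ ih ik). Qed.

Lemma rintegrableZ (r : R) h : rintegrable h -> rintegrable (fun x => r * h x).
Proof. by move=> ih; exact: (@integrableZl _ _ _ mu setT measurableT r _ ih). Qed.

Lemma rintegrable_norm h : rintegrable h -> rintegrable (fun x => `|h x|).
Proof. exact: integrable_norm. Qed.

Lemma cintegrable_normc f : cintegrable f -> rintegrable (fun x => normc (f x)).
Proof.
move=> if_; have [i1 i2] := if_.
apply: le_rintegrable (rintegrableD (rintegrable_norm i1) (rintegrable_norm i2)).
  exact/measurable_normc/cintegrable_cmeas.
by move=> x /=; rewrite ger0_norm ?normc_ge0// normc_le_ReIm.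
Qed.

Lemma le_rint h k : rintegrable h -> rintegrable k ->
  (forall x, h x <= k x) -> \int[mu]_x h x <= \int[mu]_x k x.
Proof. by move=> ih ik hk; apply: le_Rintegral. Qed.

(** The factor 2 comes from estimating the real and the imaginary part separately; the value of the
    final constant is immaterial. *)
Lemma normc_cint f : cintegrable f ->
  normc (cint f) <= 2 * \int[mu]_x normc (f x).
Proof.
move=> if_; have [i1 i2] := if_; have iN := cintegrable_normc if_.
rewrite (le_trans (normc_le_ReIm _))//= mulr_natl mulr2n lerD//;
  rewrite (le_trans (le_normr_Rintegral _ _))//; apply: le_rint => //.
- exact: rintegrable_norm.
- by move=> x; exact: Re_le_normc.
- exact: rintegrable_norm.
- by move=> x; exact: Im_le_normc.
Qed.

Lemma cintZ (c : R[i]) f : cintegrable f ->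
  cint (fun x => c * f x) = c * cint f.
Proof.
move=> [i1 i2]; case: c => a b; rewrite /cint.
under eq_Rintegral do rewrite Re_mulc /=.
under [in X in _ +i* X]eq_Rintegral do rewrite Im_mulc /=.
rewrite RintegralB ?RintegralD// ?RintegralZl//; exact: rintegrableZ.
Qed.

Lemma eq_cint f g : f =1 g -> cint f = cint g.
Proof. by move=> /funext ->. Qed.

Lemma ae_eq_cint f g : cmeas f -> cmeas g -> {ae mu, forall x, f x = g x} ->
  cint f = cint g.
Proof.
move=> [f1 f2] [g1 g2] fg; rewrite /cint /Rintegral.
by congr (fine _ +i* fine _); apply: ae_eq_integral => //;
  try exact/measurable_EFinP; apply: filterS fg => x fgx _; rewrite fgx.
Qed.

Lemma dominated_Rintegral (h_ : nat -> T -> R) h k :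
  (forall n, measurable_fun setT (h_ n)) -> measurable_fun setT h ->
  {ae mu, forall x, h_ ^~ x @ \oo --> h x} -> rintegrable k ->
  (forall n x, `|h_ n x| <= k x) ->
  (fun n => \int[mu]_x h_ n x) @ \oo --> \int[mu]_x h x.
Proof.
move=> mh_ mh hh ik hk.
have H1 n : measurable_fun setT (fun x => (h_ n x)%:E).
  exact/measurable_EFinP.
have H2 : measurable_fun setT (fun x => (h x)%:E) by exact/measurable_EFinP.
have H3 : {ae mu, forall x, setT x ->
    (fun n => (h_ n x)%:E) @ \oo --> (h x)%:E}.
  apply: filterS hh => x hx _; apply/fine_cvgP; split => //.
  exact: nearW.
have H4 : {ae mu, forall x n, setT x -> (`|(h_ n x)%:E| <= (k x)%:E)%E}.
  by apply: aeW => x n _; rewrite lee_fin.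
have [ih _ cv] := dominated_convergence measurableT H1 H2 H3 ik H4.
by apply: fine_cvg; rewrite fineK// integrable_fin_num.
Qed.

End complex_integral.

(** * Fubini's theorem for real and complex integrands *)

Section fubini_complex.
Context d1 d2 (T1 : measurableType d1) (T2 : measurableType d2) (R : realType).
Variable m1 : {sigma_finite_measure set T1 -> \bar R}.
Variable m2 : {sigma_finite_measure set T2 -> \bar R}.

Lemma rintegrable_prod (a : T1 -> R) (b : T2 -> R) (F : T1 * T2 -> R) :
  measurable_fun setT F -> rintegrable m1 a -> rintegrable m2 b ->
  (forall x y, `|F (x, y)| <= a x * b y) ->
  rintegrable (m1 \x m2)%E F.
Proof.
move=> mF ia ib Fab; apply/integrable12ltyP; first exact/measurable_EFinP.
have mb := rintegrable_measurable ib.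
have ma := rintegrable_measurable ia.
have /integrableP[_ iaoo] := ia; have /integrableP[_ iboo] := ib.
have bfin : (\int[m2]_y `|(b y)%:E|)%E \is a fin_num.
  by rewrite ge0_fin_numE//; exact: integral_ge0.
apply: (@le_lt_trans _ _ (\int[m1]_x (`|(a x)%:E| * \int[m2]_y `|(b y)%:E|))%E).
  apply: ge0_le_integral => //.
  - by move=> x _; exact: integral_ge0.
  - apply: (@measurable_fun_fubini_tonelli_F _ _ _ _ _ m2 (fun z => `|(F z)%:E|%E)) => //.
    by apply: measurableT_comp => //; exact/measurable_EFinP.
  - apply: emeasurable_funM => //.
    by apply: measurableT_comp => //; exact/measurable_EFinP.
  move=> x _; rewrite -ge0_integralZl//; last first.
    by apply: measurableT_comp => //; exact/measurable_EFinP.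
  apply: ge0_le_integral => //.
  - apply: measurableT_comp => //; apply/measurable_EFinP.
    by apply: measurableT_comp mF _ => //.
  - apply: measurable_funeM.
    by apply: measurableT_comp => //; exact/measurable_EFinP.
  move=> y _; rewrite /= -EFinM lee_fin -normrM (le_trans (Fab x y))//.
  exact: ler_norm.
rewrite ge0_integralZr//; last 2 first.
- by apply: measurableT_comp => //; exact/measurable_EFinP.
- exact: integral_ge0.
apply: lte_mul_pinfty => //; first exact: integral_ge0.
by rewrite ge0_fin_numE//; exact: integral_ge0.
Qed.

(** Slices are asked to be integrable at every point, not almost every one, so that [fine] can be
    undone inside both inner integrals. *)
Lemma Rintegral_Fubini (F : T1 * T2 -> R) : rintegrable (m1 \x m2)%E F ->
  (forall x, rintegrable m2 (fun y => F (x, y))) ->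
  (forall y, rintegrable m1 (fun x => F (x, y))) ->
  \int[m1]_x \int[m2]_y F (x, y) = \int[m2]_y \int[m1]_x F (x, y).
Proof.
move=> iF iF1 iF2; rewrite /Rintegral; congr fine.
transitivity (\int[m1]_x \int[m2]_y (F (x, y))%:E)%E.
  by apply: eq_integral => x _; rewrite fineK// integrable_fin_num//; exact: iF1.
rewrite (Fubini iF); apply: eq_integral => y _.
by rewrite fineK// integrable_fin_num//; exact: iF2.
Qed.

(** A majorant of product form makes every slice integrable, as well as the function on the
    product. *)
Lemma cint_Fubini (a : T1 -> R) (b : T2 -> R) (F : T1 * T2 -> R[i]) :
  cmeas F -> rintegrable m1 a -> rintegrable m2 b ->
  (forall x y, normc (F (x, y)) <= a x * b y) ->
  cint m1 (fun x => cint m2 (fun y => F (x, y))) =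
  cint m2 (fun y => cint m1 (fun x => F (x, y))).
Proof.
move=> [F1 F2] ia ib Fab.
have H (P : R[i] -> R) : measurable_fun setT (fun z => P (F z)) ->
    (forall z, `|P z| <= normc z) ->
    \int[m1]_x \int[m2]_y P (F (x, y)) = \int[m2]_y \int[m1]_x P (F (x, y)).
  move=> mP Pn; apply: (@Rintegral_Fubini (fun z => P (F z))).
  - by apply: rintegrable_prod ia ib _ => // x y; rewrite (le_trans (Pn _)).
  - move=> x; apply: le_rintegrable (rintegrableZ (a x) ib).
      by apply: measurableT_comp mP _ => //.
    by move=> y /=; rewrite (le_trans (Pn _)).
  - move=> y; apply: le_rintegrable (rintegrableZ (b y) ia).
      by apply: measurableT_comp mP _ => //.
    by move=> x /=; rewrite (le_trans (Pn _))// mulrC.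
rewrite /cint /= !H//; [exact: Im_le_normc|exact: Re_le_normc].
Qed.

End fubini_complex.

(* The library's sigma-finiteness instance for products is not found by
   unification, hence this alias of the plane Lebesgue measure. *)
Definition area (R : realType) : set (measurableTypeR R * measurableTypeR R) -> \bar R :=
  (@lebesgue_measure R \x @lebesgue_measure R)%E.
Arguments area : clear implicits.
HB.instance Definition _ (R : realType) := Measure.copy (area R)
  (@lebesgue_measure R \x @lebesgue_measure R)%E.

Lemma area_sigma_finite (R : realType) : sigma_finite setT (area R).
Proof.
pose I n : set (measurableTypeR R) := `[- n%:R, n%:R]%classic.
exists (fun n => I n `*` I n).
  apply/esym/seteqP; split => // -[a b] _.
  have [n _ /(_ n (leqnn n)) h] := nbhs_infty_ger (`|a| + `|b|).
  exists n => //.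
  by split; rewrite /I/= in_itv/= -ler_norml (le_trans _ h)// ?lerDl ?lerDr.
move=> n; split; first by apply: measurableX; exact: measurable_itv.
have oo : (lebesgue_measure (I n) < +oo)%E.
  by rewrite lebesgue_measure_itv/=; case: ifP => // _; rewrite -EFinD ltry.
have -> : area R (I n `*` I n) =
    (lebesgue_measure (I n) * lebesgue_measure (I n))%E.
  by apply: product_measure1E; exact: measurable_itv.
by apply: lte_mul_pinfty => //; rewrite ge0_fin_numE.
Qed.
HB.instance Definition _ (R : realType) :=
  Measure_isSigmaFinite.Build _ _ _ (area R) (area_sigma_finite R).

(** * The Fourier transform in the plane *)

Lemma measurable_Rintegral d1 d2 (T1 : measurableType d1)
    (T2 : measurableType d2) (R : realType)
    (m2 : {sigma_finite_measure set T2 -> \bar R}) (F : T1 * T2 -> R) :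
  measurable_fun setT F ->
  measurable_fun setT (fun x => \int[m2]_y F (x, y)).
Proof.
move=> mF; rewrite /Rintegral.
apply: measurableT_comp => //.
rewrite [X in measurable_fun _ X](_ : _ = (fun x =>
  (\int[m2]_y (fun z => (F z)%:E)^\+ (x, y) -
   \int[m2]_y (fun z => (F z)%:E)^\- (x, y)))%E); last first.
  apply/funext => x; rewrite [LHS]integralE.
  by congr (_ - _)%E; apply: eq_integral => y _; rewrite ?funeposE ?funenegE.
have mF' : measurable_fun setT (fun z => (F z)%:E) by exact/measurable_EFinP.
apply: emeasurable_funB.
  apply: (@measurable_fun_fubini_tonelli_F _ _ _ _ _ m2 (fun z => (F z)%:E)^\+%E) => //.
  exact: measurable_funepos.
apply: (@measurable_fun_fubini_tonelli_F _ _ _ _ _ m2 (fun z => (F z)%:E)^\-%E) => //.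
exact: measurable_funeneg.
Qed.

Section plane.
Context {R : realType}.
Local Notation T2 := (measurableTypeR R * measurableTypeR R)%type.
Local Notation leb := (@lebesgue_measure R).
Local Notation P := (area R).
Implicit Types f g h : T2 -> R[i].

Lemma cintegralE f : cintegral f = cint P f.
Proof. by []. Qed.

(** The sign [s] lets one development serve both transforms: -1 for the direct one, 1 for the
    inverse one without its factor. *)
Definition ft (s : R) f : T2 -> R[i] :=
  fun xi => cint P (fun x => expi (s * dot2 x xi) * f x).

Lemma fourier1E f : fourier1 f = ft (-1) f.
Proof. by apply/funext => xi; rewrite /fourier1 /ft; under [RHS]eq_cint do rewrite mulN1r. Qed.

Lemma inv_fourier1E f : inv_fourier1 f =
  fun x => ((2 * pi) ^- 2 : R)%:C * ft 1 f x.
Proof.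
apply/funext => x; rewrite /inv_fourier1 /ft; congr (_ * _).
rewrite cintegralE; apply: eq_cint => xi.
by rewrite mul1r /dot2 [x.1 * _]mulrC [x.2 * _]mulrC.
Qed.

Lemma measurable_dot2 : measurable_fun setT
  (fun z : T2 * T2 => dot2 z.1 z.2).
Proof.
have m1 : measurable_fun setT (fun z : T2 * T2 => z.1.1).
  by apply: measurableT_comp.
have m2 : measurable_fun setT (fun z : T2 * T2 => z.1.2).
  by apply: measurableT_comp.
have m3 : measurable_fun setT (fun z : T2 * T2 => z.2.1).
  by apply: measurableT_comp.
have m4 : measurable_fun setT (fun z : T2 * T2 => z.2.2).
  by apply: measurableT_comp.
by apply: measurable_funD; apply: measurable_funM.
Qed.

Lemma dot2C (x y : R * R) : dot2 x y = dot2 y x.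
Proof. by rewrite /dot2 mulrC [x.2 * _]mulrC. Qed.

Lemma measurable_dot2r (y : T2) : measurable_fun setT (fun x : T2 => dot2 x y).
Proof. by apply: measurable_funD; apply: measurable_funM. Qed.

Lemma measurable_norm2 : measurable_fun setT (fun x : T2 => norm2 x).
Proof.
have ms : measurable_fun setT (@Num.sqrt R).
  by apply: continuous_measurable_fun; exact: sqrt_continuous.
apply: (measurableT_comp ms).
by apply: measurable_funD; apply: measurable_funX.
Qed.

Lemma cmeas_kernel s f : cmeas f ->
  cmeas (fun z : T2 * T2 => expi (s * dot2 z.2 z.1) * f z.2).
Proof.
move=> [f1 f2]; apply: cmeasM.
  apply: cmeas_expi; apply: measurable_funM => //.
  by under eq_fun do rewrite dot2C; exact: measurable_dot2.
by split; [apply: (measurableT_comp f1)|apply: (measurableT_comp f2)].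
Qed.

Lemma cmeas_ft s f : cmeas f -> cmeas (ft s f).
Proof.
move=> /(cmeas_kernel s) [m1 m2]; split.
  have H := (@measurable_Rintegral _ _ T2 T2 R P _ m1). refine H.
exact: (@measurable_Rintegral _ _ T2 T2 R P _ m2).
Qed.

Lemma normc_expiM (a : R) (z : R[i]) : normc (expi a * z) = normc z.
Proof. by rewrite Normc.normcM normc_expi mul1r. Qed.

Lemma cintegrable_expi s f xi : cintegrable P f ->
  cintegrable P (fun x => expi (s * dot2 x xi) * f x).
Proof.
move=> if_; apply: (le_cintegrable _ _ (cintegrable_normc if_)) => [|x].
  apply: cmeasM; last exact: cintegrable_cmeas if_.
  by apply: cmeas_expi; apply: measurable_funM => //; exact: measurable_dot2r.
by rewrite normc_expiM.
Qed.

Lemma normc_ft s f xi : cintegrable P f ->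
  normc (ft s f xi) <= 2 * \int[P]_x normc (f x).
Proof.
move=> if_; rewrite (le_trans (normc_cint (cintegrable_expi s xi if_)))//.
by rewrite ler_wpM2l//; under eq_Rintegral do rewrite normc_expiM.
Qed.

(** Fubini with majorant |f(x)| |g(y)|, the kernel being symmetric and of modulus 1. It replaces
    Plancherel and inversion arguments throughout. *)
Lemma ft_multiplication s f g : cintegrable P f -> cintegrable P g ->
  cint P (fun x => f x * ft s g x) = cint P (fun y => g y * ft s f y).
Proof.
move=> if_ ig; have mf := cintegrable_cmeas if_; have mg := cintegrable_cmeas ig.
pose F (z : T2 * T2) := f z.1 * (expi (s * dot2 z.2 z.1) * g z.2).
transitivity (cint P (fun x => cint P (fun y => F (x, y)))).
  by apply: eq_cint => x; rewrite -cintZ//; exact: cintegrable_expi.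
rewrite (cint_Fubini _ (cintegrable_normc if_) (cintegrable_normc ig)).
- apply: eq_cint => y; rewrite -cintZ; last exact: cintegrable_expi.
  by apply: eq_cint => x; rewrite /F /= dot2C; ring.
- rewrite /F; apply: cmeasM; last exact: cmeas_kernel.
  case: mf => f1 f2.
  by split; [apply: (measurableT_comp f1)|apply: (measurableT_comp f2)].
- by move=> x y; rewrite /F /= Normc.normcM normc_expiM.
Qed.

Lemma cLnorm1E f : cLnorm 1%:E f = (\int[P]_x (normc (f x))%:E)%E.
Proof.
rewrite /cLnorm Lnorm1; apply: eq_integral => x _.
by rewrite gee0_abs// lee_fin normc_ge0.
Qed.

Lemma inL1_cintegrable f : inL 1%:E f -> cintegrable P f.
Proof.
move=> [mf]; rewrite cLnorm1E => foo.
apply: (@le_cintegrable _ _ _ _ _ (fun x => normc (f x))) => //.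
apply/integrableP; split; first exact/measurable_EFinP/measurable_normc.
by under eq_integral do rewrite gee0_abs ?lee_fin ?normc_ge0//.
Qed.

Lemma cLnorm2E f :
  (cLnorm 2%:E f `^ 2)%E = (\int[P]_x (normc (f x) ^+ 2)%:E)%E.
Proof.
rewrite /cLnorm poweR_Lnorm//; apply: eq_integral => x _.
by rewrite poweR_EFin ger0_norm ?normc_ge0// powR_mulrn// normc_ge0.
Qed.

Lemma inL2_rintegrable f : inL 2%:E f -> rintegrable P (fun x => normc (f x) ^+ 2).
Proof.
move=> [mf foo]; apply/integrableP; split.
  by apply/measurable_EFinP; apply: measurable_funX; exact: measurable_normc.
under eq_integral do rewrite gee0_abs ?lee_fin ?sqr_ge0//.
by rewrite -cLnorm2E poweR_lty.
Qed.

Lemma cLnorm2_cvg0 (h_ : nat -> T2 -> R[i]) :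
  (fun n => cLnorm 2%:E (h_ n)) @ \oo --> 0%E ->
  (fun n => \int[P]_x (normc (h_ n x) ^+ 2)%:E)%E @ \oo --> 0%E.
Proof.
move=> /fine_cvgP[fin cv]; under eq_fun do rewrite -cLnorm2E.
apply/fine_cvgP; split.
  by apply: filterS fin => n /= fn; exact: fin_num_poweR.
rewrite (_ : _ \o _ = fun n => (fine (cLnorm 2%:E (h_ n))) * (fine (cLnorm 2%:E (h_ n)))).
  by rewrite -[0]/(fine 0) -[X in _ --> X](mulr0 0); apply: cvgM.
apply/funext => n /=; rewrite fine_poweR powR_mulrn ?expr2//.
by rewrite fine_ge0// Lnorm_ge0.
Qed.

(** Fatou's lemma applied to |h_n - g|^2 bounds the integral of |h - g|^2 by 0. This ties the
    transforms defined as L^2 limits to pointwise integrals. *)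
Lemma cLnorm2_limit (h_ : nat -> T2 -> R[i]) h g :
  (forall n, cmeas (h_ n)) -> cmeas h -> cmeas g ->
  (forall x, (fun n => Re (h_ n x)) @ \oo --> Re (h x)) ->
  (forall x, (fun n => Im (h_ n x)) @ \oo --> Im (h x)) ->
  (fun n => cLnorm 2%:E (fun x => h_ n x - g x)) @ \oo --> 0%E ->
  {ae P, forall x, h x = g x}.
Proof.
move=> mh_ mh mg hRe hIm /cLnorm2_cvg0 cv.
pose phi n x := (normc (h_ n x - g x) ^+ 2)%:E.
have mphi n : measurable_fun setT (phi n).
  apply/measurable_EFinP; apply: measurable_funX; apply: measurable_normc.
  exact: cmeasB.
have phi0 n x : setT x -> (0 <= phi n x)%E by rewrite lee_fin sqr_ge0.
have cphi x : (phi n x @[n --> \oo] --> (normc (h x - g x) ^+ 2)%:E)%E.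
  apply: cvg_EFin; first exact: nearW.
  rewrite /phi /=; under eq_fun do rewrite /= sqr_normcE Re_subc Im_subc.
  rewrite sqr_normcE Re_subc Im_subc.
  by apply: cvgD; rewrite expr2; under eq_fun do rewrite expr2; apply: cvgM;
    apply: cvgB => //; exact: cvg_cst.
have := fatou P measurableT mphi phi0.
rewrite (is_cvg_limn_einfE (cvgP _ cv)) (cvg_lim _ cv)//.
rewrite (_ : (\int[P]_(x in _) _)%E = \int[P]_x `|(normc (h x - g x) ^+ 2)%:E|)%E; last first.
  apply: eq_integral => x _.
  rewrite (is_cvg_limn_einfE (cvgP _ (cphi x))) (cvg_lim _ (cphi x))//.
  by rewrite gee0_abs// lee_fin sqr_ge0.
move=> le0; have /ae_eq_integral_abs : (\int[P]_x `|(normc (h x - g x) ^+ 2)%:E|)%E = 0%E.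
  by apply/eqP; rewrite eq_le le0 integral_ge0.
move=> /(_ measurableT) H; apply: filterS (H _) => [x /(_ I)|].
  move=> /eqP; rewrite eqe sqrf_eq0 => /eqP /Normc.eq0_normc /eqP.
  by rewrite subr_eq0 => /eqP.
apply/measurable_EFinP; apply: measurable_funX; apply: measurable_normc.
exact: cmeasB.
Qed.

Lemma cmeas_truncate n f : cmeas f -> cmeas (truncate n f).
Proof.
have mb : measurable_fun setT (fun x : T2 => norm2 x <= n%:R).
  by apply: measurable_fun_ler => //; exact: measurable_norm2.
move=> [f1 f2]; split.
  rewrite (_ : (fun x => _) = fun x => if norm2 x <= n%:R then Re (f x) else 0).
    exact: measurable_fun_ifT.
  by apply/funext => x; rewrite /truncate; case: ifP.
rewrite (_ : (fun x => _) = fun x => if norm2 x <= n%:R then Im (f x) else 0).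
  exact: measurable_fun_ifT.
by apply/funext => x; rewrite /truncate; case: ifP.
Qed.

(** The truncated integrals converge at every frequency by dominated convergence with majorant |f|,
    so their pointwise limit must be the L^2 limit. *)
Lemma is_fourier_L1 f g : is_fourier f g -> inL 1%:E f ->
  {ae P, forall xi, ft (-1) f xi = g xi}.
Proof.
move=> [[mf _] [mg _] cv] /inL1_cintegrable if_.
have iN := cintegrable_normc if_.
have le_tr n x : normc (truncate n f x) <= normc (f x).
  by rewrite /truncate; case: ifP => // _; rewrite Normc.normc0 normc_ge0.
have cvt (p : R[i] -> R) (xi : T2) : (forall z, `|p z| <= normc z) ->
    (forall h, cmeas h -> measurable_fun setT (fun x => p (h x))) ->
  (fun n => \int[P]_x p (expi (-1 * dot2 x xi) * truncate n f x)) @ \oo -->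
    \int[P]_x p (expi (-1 * dot2 x xi) * f x).
  move=> pn mp; apply: dominated_Rintegral iN _ => [n|||n x].
  - apply: mp; apply: cmeasM; last exact: cmeas_truncate.
    by apply: cmeas_expi; apply: measurable_funM => //; exact: measurable_dot2r.
  - apply: mp; apply: cmeasM => //.
    by apply: cmeas_expi; apply: measurable_funM => //; exact: measurable_dot2r.
  - apply: aeW => x; apply: cvg_near_cst.
    near=> n; rewrite /truncate ifT//.
    by near: n; exact: nbhs_infty_ger.
  - by rewrite (le_trans (pn _))// normc_expiM.
apply: (@cLnorm2_limit (fun n => ft (-1) (truncate n f))) => //.
- by move=> n; apply: cmeas_ft; exact: cmeas_truncate.
- exact: cmeas_ft.
- by move=> xi; exact: (cvt _ xi (@Re_le_normc _) (fun h mh => mh.1)).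
- by move=> xi; exact: (cvt _ xi (@Im_le_normc _) (fun h mh => mh.2)).
- by under eq_fun do rewrite -fourier1E.
Unshelve. all: by end_near. Qed.

(** Once the truncation radius exceeds [L] the approximating sequence is constant. [G] is a second
    representative of [g] because the one with bounded support may agree with the given symbol only
    almost everywhere. *)
Lemma is_inv_fourier_compact g G f (L : R) : is_inv_fourier g f ->
  cmeas G -> {ae P, forall x, g x = G x} ->
  (forall x, G x != 0 -> norm2 x <= L) ->
  {ae P, forall x, ((2 * pi) ^- 2 : R)%:C * ft 1 G x = f x}.
Proof.
move=> [[mg _] [mf _] cv] mG gG GL.
have mc h : cmeas h -> cmeas (fun x => ((2 * pi) ^- 2 : R)%:C * ft 1 h x).
  move=> mh; apply: cmeasM; first exact: cmeas_cst.
  exact: cmeas_ft.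
have ev : \forall n \near \oo, inv_fourier1 (truncate n g) =
    fun x => ((2 * pi) ^- 2 : R)%:C * ft 1 G x.
  near=> n; rewrite inv_fourier1E; apply/funext => x; congr (_ * _).
  apply: ae_eq_cint.
  - apply: cmeasM; last exact: cmeas_truncate.
    by apply: cmeas_expi; apply: measurable_funM => //; exact: measurable_dot2r.
  - apply: cmeasM => //.
    by apply: cmeas_expi; apply: measurable_funM => //; exact: measurable_dot2r.
  apply: filterS gG => y; rewrite /truncate => ->; case: ifPn => // yn.
  have [->//|/GL yL] := eqVneq (G y) 0.
  move: yn; rewrite (le_trans yL)//; near: n; exact: nbhs_infty_ger.
apply: (@cLnorm2_limit (fun n => inv_fourier1 (truncate n g))) => //.
- by move=> n; rewrite inv_fourier1E; apply: mc; exact: cmeas_truncate.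
- exact: mc.
- by move=> x; apply: cvg_near_cst; apply: filterS ev => n ->.
- by move=> x; apply: cvg_near_cst; apply: filterS ev => n ->.
Unshelve. all: by end_near. Qed.

Lemma rintegrable_box (L : R) : rintegrable P
  (fun x : T2 => \1_(`[- L, L]%classic) x.1 * \1_(`[- L, L]%classic) x.2 : R).
Proof.
have iI : rintegrable leb (\1_(`[- L, L]%classic) : R -> R).
  exact: integrable_indic_itv.
have mI : measurable_fun setT (\1_(`[- L, L]%classic) : R -> R).
  exact: measurable_indic.
apply: (rintegrable_prod _ iI iI) => [|x y].
  apply: measurable_funM.
    by apply: (measurableT_comp mI).
  by apply: (measurableT_comp mI).
by rewrite ger0_norm// mulr_ge0// indicE.
Qed.

Lemma norm2_le_abs (x : R * R) : `|x.1| <= norm2 x /\ `|x.2| <= norm2 x.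
Proof.
by split; rewrite /norm2 -sqrtr_sqr ler_wsqrtr// ?lerDl ?lerDr sqr_ge0.
Qed.

Lemma norm2_box (L : R) (x : R * R) : norm2 x <= L ->
  \1_(`[- L, L]%classic) x.1 * \1_(`[- L, L]%classic) x.2 = 1 :> R.
Proof.
move=> xL; have [x1 x2] := norm2_le_abs x.
by rewrite !indicE !mem_set ?mulr1//= in_itv/= -ler_norml (le_trans _ xL).
Qed.

(** On the support |f| <= 1 + |f|^2, and the constant is integrable over the enclosing box. *)
Lemma inL2_compact_cintegrable f (L : R) : inL 2%:E f ->
  (forall x, f x != 0 -> norm2 x <= L) -> cintegrable P f.
Proof.
move=> f2 fL; have [mf _] := f2.
apply: le_cintegrable (rintegrableD (rintegrable_box L) (inL2_rintegrable f2)) => // x.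
have [->|/fL xL] := eqVneq (f x) 0.
  by rewrite Normc.normc0 addr_ge0 ?sqr_ge0// mulr_ge0// indicE.
rewrite norm2_box// -subr_ge0.
have -> : 1 + normc (f x) ^+ 2 - normc (f x) = (normc (f x) - 2^-1) ^+ 2 + 3 / 4 by field.
by rewrite addr_ge0 ?sqr_ge0.
Qed.

Lemma cLnormy_le f (B : R) : 0 <= B -> {ae P, forall x, normc (f x) <= B} ->
  (cLnorm +oo f <= B%:E)%E.
Proof.
move=> B0 fB; rewrite /cLnorm unlock; case: ifPn => _; last by rewrite lee_fin.
apply/ess_supP; apply: filterS fB => x fx /=.
by rewrite lee_fin ger0_norm// normc_ge0.
Qed.

End plane.

(** * Calculus rules and iterated integrals *)

Section derive_rules.
Context {R : realType}.
Implicit Types (f g : R -> R) (x a b : R).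

Lemma deriv_eq f x a b : is_derive x 1 f a -> a = b -> is_derive x 1 f b.
Proof. by move=> df <-. Qed.

Lemma deriv_cst c x : is_derive x 1 (fun=> c : R) 0.
Proof. exact: is_derive_cst. Qed.

Lemma deriv_id x : is_derive x 1 (fun y : R => y) 1.
Proof. exact: is_derive_id. Qed.

Lemma deriv_add f g x a b : is_derive x 1 f a -> is_derive x 1 g b ->
  is_derive x 1 (fun y => f y + g y) (a + b).
Proof. by move=> df dg; exact: is_deriveD. Qed.

Lemma deriv_sub f g x a b : is_derive x 1 f a -> is_derive x 1 g b ->
  is_derive x 1 (fun y => f y - g y) (a - b).
Proof. by move=> df dg; exact: is_deriveB. Qed.

Lemma deriv_opp f x a : is_derive x 1 f a -> is_derive x 1 (fun y => - f y) (- a).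
Proof. by move=> df; exact: is_deriveN. Qed.

Lemma deriv_mul f g x a b : is_derive x 1 f a -> is_derive x 1 g b ->
  is_derive x 1 (fun y => f y * g y) (f x * b + g x * a).
Proof. by move=> df dg; exact: is_deriveM. Qed.

Lemma deriv_comp f g x a b : is_derive (g x) 1 f a -> is_derive x 1 g b ->
  is_derive x 1 (fun y => f (g y)) (a * b).
Proof. by move=> df dg; exact: is_derive1_comp. Qed.

Lemma deriv_sqr f x a : is_derive x 1 f a ->
  is_derive x 1 (fun y => f y ^+ 2) (2 * f x * a).
Proof.
move=> df; rewrite (_ : (fun y => _) = fun y => f y * f y); last first.
  by apply/funext => y; rewrite expr2.
by apply: deriv_eq (deriv_mul df df) _; ring.
Qed.

Lemma deriv_inv f x a : f x != 0 -> is_derive x 1 f a ->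
  is_derive x 1 (fun y => (f y)^-1) (- a / f x ^+ 2).
Proof.
move=> fx df; apply: deriv_eq (@is_deriveV R f x a 1 fx df) _.
by rewrite /GRing.scale/= !mulNr mulrC.
Qed.

Lemma deriv_sin f x a : is_derive x 1 f a ->
  is_derive x 1 (fun y => sin (f y)) (cos (f x) * a).
Proof. by move=> df; apply: deriv_comp => //; exact: is_derive_sin. Qed.

Lemma deriv_cos f x a : is_derive x 1 f a ->
  is_derive x 1 (fun y => cos (f y)) (- sin (f x) * a).
Proof. by move=> df; apply: deriv_comp => //; exact: is_derive_cos. Qed.

Lemma deriv_atan f x a : is_derive x 1 f a ->
  is_derive x 1 (fun y => atan (f y)) ((1 + f x ^+ 2)^-1 * a).
Proof. by move=> df; apply: deriv_comp => //; exact: is_derive1_atan. Qed.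

Lemma deriv_sqrt f x a : 0 < f x -> is_derive x 1 f a ->
  is_derive x 1 (fun y => Num.sqrt (f y)) ((2 * Num.sqrt (f x))^-1 * a).
Proof. by move=> fx df; apply: deriv_comp => //; exact: is_derive1_sqrt. Qed.

Lemma is_derive_continuous f x a : is_derive x 1 f a -> {for x, continuous f}.
Proof.
by case=> df _; apply: differentiable_continuous; apply/derivable1_diffP.
Qed.

End derive_rules.

(* Type class resolution would otherwise find derivatives stated with [*:]. *)
Ltac der_step := first
  [ notypeclasses refine (deriv_cst _ _) | notypeclasses refine (deriv_id _) | eassumption
  | notypeclasses refine (deriv_sub _ _) | notypeclasses refine (deriv_opp _)
  | notypeclasses refine (deriv_add _ _) | notypeclasses refine (deriv_sqr _)
  | notypeclasses refine (deriv_mul _ _) | notypeclasses refine (deriv_inv _ _)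
  | notypeclasses refine (deriv_sin _) | notypeclasses refine (deriv_cos _)
  | notypeclasses refine (deriv_atan _) | notypeclasses refine (deriv_sqrt _ _) ].
Ltac der := notypeclasses refine (deriv_eq _ _); [repeat der_step ..|cbv beta].

(** * Iterated integrals of functions supported in a square *)

Section iterated.
Context {R : realType}.
Local Notation T2 := (measurableTypeR R * measurableTypeR R)%type.
Local Notation leb := (@lebesgue_measure R).
Implicit Types (f h : R -> R) (F : T2 -> R) (L M B : R).

Definition ind L : R -> R := \1_(`[- L, L]%classic).

Lemma ind_ge0 L x : 0 <= ind L x.
Proof. by rewrite /ind indicE. Qed.

Lemma ind_in L x : `|x| <= L -> ind L x = 1.
Proof. by move=> xL; rewrite /ind indicE mem_set//= in_itv/= -ler_norml. Qed.

Lemma ind_out L x : L < `|x| -> ind L x = 0.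
Proof.
by move=> xL; rewrite /ind indicE memNset//= in_itv/= -ler_norml leNgt xL.
Qed.

Lemma rintegrable_ind L : rintegrable leb (ind L).
Proof. exact: integrable_indic_itv. Qed.

Lemma measurable_ind L : measurable_fun setT (ind L).
Proof. exact: measurable_indic. Qed.

Lemma Rintegral_ind L : 0 <= L -> \int[leb]_x ind L x = 2 * L.
Proof.
move=> L0; rewrite /Rintegral /ind integral_indic ?setIT//.
suff E : lebesgue_measure `[- L, L]%classic = (2 * L)%:E.
  by rewrite -[RHS]/(fine (2 * L)%:E) -E.
rewrite lebesgue_measure_itv/=.
case: ifPn => [_|]; first by rewrite -EFinD; congr EFin; ring.
rewrite lte_fin -leNgt => LL; have -> : L = 0 by lra.
by rewrite mulr0.
Qed.

Lemma rintegrable_bounded f L M : measurable_fun setT f ->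
  (forall x, `|f x| <= M * ind L x) -> rintegrable leb f.
Proof.
move=> mf fM; apply: (@le_rintegrable _ _ _ leb f (fun x => M * ind L x)) => //.
by apply: rintegrableZ; exact: rintegrable_ind.
Qed.

Lemma Rintegral_bounded f L B : 0 <= L -> measurable_fun setT f ->
  (forall x, `|f x| <= B * ind L x) -> `|\int[leb]_x f x| <= 2 * L * B.
Proof.
move=> L0 mf fB; have if_ := rintegrable_bounded mf fB.
rewrite (le_trans (le_normr_Rintegral _ _))//.
rewrite (@le_trans _ _ (\int[leb]_x (B * ind L x)))//.
  apply: le_rint => //; first exact: rintegrable_norm.
  by apply: rintegrableZ; exact: rintegrable_ind.
by rewrite RintegralZl//; [rewrite Rintegral_ind// mulrC|exact: rintegrable_ind].
Qed.

Lemma rintegrable_area_bounded F L M : measurable_fun setT F ->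
  (forall x y, `|F (x, y)| <= M * (ind L x * ind L y)) ->
  rintegrable (area R) F.
Proof.
move=> mF FM.
apply: (rintegrable_prod mF (rintegrableZ M (rintegrable_ind L)) (rintegrable_ind L)).
by move=> x y; rewrite -mulrA.
Qed.

(** [M] provides the support in the square and the integrability for Fubini, and is absent from the
    conclusion: it may depend badly on parameters as long as the slice bound [B] does not. The
    factor 2 L is the length of the outer interval. *)
Lemma Rintegral_area1 F L M B : 0 <= L -> measurable_fun setT F ->
  (forall x y, `|F (x, y)| <= M * (ind L x * ind L y)) ->
  (forall x, `|\int[leb]_y F (x, y)| <= B) ->
  `|\int[area R]_z F z| <= 2 * L * B.
Proof.
move=> L0 mF FM FB.
have iF := rintegrable_area_bounded mF FM.
have m1 x : measurable_fun setT (fun y => F (x, y)).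
  by apply: measurableT_comp mF _ => //.
have i1 x : rintegrable leb (fun y => F (x, y)).
  apply: (@rintegrable_bounded _ L (M * ind L x) (m1 x)) => y.
  by rewrite -mulrA.
have -> : \int[area R]_z F z = \int[leb]_x \int[leb]_y F (x, y).
  rewrite /Rintegral; congr fine; rewrite -(integral12_prod_meas1 iF).
  by apply: eq_integral => x _; rewrite fineK// integrable_fin_num//; exact: i1.
apply: Rintegral_bounded => //.
  exact: (@measurable_Rintegral _ _ _ _ R leb F mF).
move=> x; have [xL|xL] := leP `|x| L; first by rewrite ind_in// mulr1.
rewrite ind_out// mulr0 (_ : (fun y => F (x, y)) = cst 0).
  by rewrite /Rintegral integral0 normr0.
apply/funext => y; apply/eqP; rewrite -normr_le0.
by rewrite (le_trans (FM x y))// ind_out// mul0r mulr0.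
Qed.

Lemma Rintegral_area2 F L M B : 0 <= L -> measurable_fun setT F ->
  (forall x y, `|F (x, y)| <= M * (ind L x * ind L y)) ->
  (forall y, `|\int[leb]_x F (x, y)| <= B) ->
  `|\int[area R]_z F z| <= 2 * L * B.
Proof.
move=> L0 mF FM FB.
have iF := rintegrable_area_bounded mF FM.
have m2 y : measurable_fun setT (fun x => F (x, y)).
  by apply: measurableT_comp mF _ => //.
have i2 y : rintegrable leb (fun x => F (x, y)).
  apply: (@rintegrable_bounded _ L (M * ind L y) (m2 y)) => x.
  by rewrite -mulrA [ind L y * _]mulrC.
have mS : measurable_fun setT (fun z : T2 => F (z.2, z.1)).
  by apply: measurableT_comp mF _; exact: measurable_swap.
have -> : \int[area R]_z F z = \int[leb]_y \int[leb]_x F (x, y).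
  rewrite /Rintegral; congr fine; rewrite -(integral21_prod_meas1 iF).
  by apply: eq_integral => y _; rewrite fineK// integrable_fin_num//; exact: i2.
apply: Rintegral_bounded => //.
  exact: (@measurable_Rintegral _ _ _ _ R leb (fun z => F (z.2, z.1)) mS).
move=> y; have [yL|yL] := leP `|y| L; first by rewrite ind_in// mulr1.
rewrite ind_out// mulr0 (_ : (fun x => F (x, y)) = cst 0).
  by rewrite /Rintegral integral0 normr0.
apply/funext => x; apply/eqP; rewrite -normr_le0.
by rewrite (le_trans (FM x y))// [ind L y]ind_out// !mulr0.
Qed.

Lemma Rintegral_FTC (h H : R -> R) (f : R -> R) L : 0 < L ->
  continuous h -> (forall x : R, is_derive x 1 H (h x)) ->
  (forall x, f x = ind L x * h x) ->
  \int[leb]_x f x = H L - H (- L).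
Proof.
move=> L0 ch dH fh.
have -> : \int[leb]_x f x = \int[leb]_(x in `[- L, L]) h x.
  rewrite [RHS]Rintegral_mkcond; apply: eq_Rintegral => x _.
  rewrite fh patchE /ind indicE; case: (x \in _); first by rewrite mul1r.
  by rewrite mul0r.
have cH x : {for x, continuous H}.
  by apply: differentiable_continuous; apply/derivable1_diffP; case: (dH x).
rewrite /Rintegral; suff -> : (\int[leb]_(x in `[(- L)%R, L]) (h x)%:E =
    (H L)%:E - (H (- L)%R)%:E)%E by [].
apply: continuous_FTC2.
- lra.
- exact: continuous_subspaceT.
- split => [x _||]; first by case: (dH x).
    by apply: cvg_at_right_filter; exact: cH.
  by apply: cvg_at_left_filter; exact: cH.
- by move=> x _; rewrite derive1E; apply: derive_val.
Qed.

End iterated.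

(** * Fourier inversion outside the support *)

Section bump.
Context {R : realType}.
Local Notation T2 := (measurableTypeR R * measurableTypeR R)%type.
Local Notation leb := (@lebesgue_measure R).
Implicit Types (N s b x d : R).

(* Vanishing to second order at [-N] and [N], this function has a Fourier
   transform of size N^-2 away from 0, which beats the growth N of the
   transform at 0. *)
Definition bump N x : R := ind N x * (1 - N^-1 ^+ 2 * x ^+ 2) ^+ 2.

Lemma measurable_bump N : measurable_fun setT (bump N).
Proof.
apply: measurable_funM; first exact: measurable_ind.
apply: measurable_funX; apply: measurable_funB => //.
by apply: measurable_funM => //; exact: measurable_funX.
Qed.

Lemma bump_le N x : 0 < N -> 0 <= bump N x <= ind N x.
Proof.
move=> N0; have [xN|xN] := leP `|x| N; last first.
  by rewrite /bump ind_out// mul0r lexx.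
rewrite /bump ind_in// mul1r sqr_ge0/=.
have h0 : 0 <= N^-1 ^+ 2 * x ^+ 2 by rewrite mulr_ge0// sqr_ge0.
have h1 : N^-1 ^+ 2 * x ^+ 2 <= 1.
  by rewrite exprVn mulrC ler_pdivrMr ?exprn_gt0// mul1r -[x ^+ 2]real_normK ?num_real// lerXn2r// nnegrE ltW.
by rewrite expr_le1//; lra.
Qed.

(** [H] is the primitive found by integrating by parts until the quartic polynomial is exhausted;
    its five coefficients are the successive derivatives. At x = N and x = -N the polynomial and its
    first derivative vanish, and the higher ones are at most 8 a, 24 a^2 N and 24 a^2 with a = N^-2;
    hence the numerators 8, 24, 24, and the factor 2 for the two endpoints. *)
Lemma bump_cos N s b d : 1 <= N -> 0 < d -> d <= `|s| ->
  `|\int[leb]_x (bump N x * cos (s * x + b))| <=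
  2 * N^-1 ^+ 2 * (8 / d ^+ 3 + 24 / d ^+ 4 + 24 / d ^+ 5).
Proof.
move=> N1 d0 ds.
have N0 : 0 < N by lra.
have s0 : s != 0 by rewrite -normr_gt0; lra.
set a := N^-1 ^+ 2.
pose h x := (1 - a * x ^+ 2) ^+ 2 * cos (s * x + b).
pose H x := (1 - a * x ^+ 2) ^+ 2 * (sin (s * x + b) * s^-1)
  + (- 4 * a * x * (1 - a * x ^+ 2)) * (cos (s * x + b) * s^-1 ^+ 2)
  - (- 4 * a + 12 * a ^+ 2 * x ^+ 2) * (sin (s * x + b) * s^-1 ^+ 3)
  - (24 * a ^+ 2 * x) * (cos (s * x + b) * s^-1 ^+ 4)
  + 24 * a ^+ 2 * (sin (s * x + b) * s^-1 ^+ 5).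
have dH x : is_derive x 1 H (h x).
  by rewrite /H /h; der; field.
have ch : continuous h.
  move=> x; by apply: is_derive_continuous.
rewrite (Rintegral_FTC N0 ch dH) => [|x]; last first.
  by rewrite /bump /h -mulrA.
have aN : a * N ^+ 2 = 1 by rewrite /a exprVn mulVf// expf_neq0// gt_eqF.
have a1 : a <= 1.
  by rewrite /a exprVn invf_le1 ?exprn_gt0// exprn_ege1.
have a0 : 0 <= a by rewrite sqr_ge0.
have aN1 : a * N <= 1.
  by rewrite -aN ler_wpM2l// expr2 ler_peMl// ltW.
have B y : y ^+ 2 = N ^+ 2 ->
    `|H y| <= a * (8 / d ^+ 3 + 24 / d ^+ 4 + 24 / d ^+ 5).
  move=> yN.
  have -> : H y = - (8 * a) * (sin (s * y + b) * s^-1 ^+ 3)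
     - (24 * a ^+ 2 * y) * (cos (s * y + b) * s^-1 ^+ 4)
     + 24 * a ^+ 2 * (sin (s * y + b) * s^-1 ^+ 5).
    rewrite /H yN.
    have -> : 12 * a ^+ 2 * N ^+ 2 = 12 * a by rewrite -[RHS]mulr1 -aN; ring.
    by rewrite aN; ring.
  have sd n : `|s^-1 ^+ n| <= (d ^+ n)^-1.
    rewrite normrX normfV exprVn lef_pV2 ?posrE ?exprn_gt0//; last lra.
    by rewrite lerXn2r// nnegrE; lra.
  have yN' : `|y| = N.
    by apply/eqP; rewrite -(eqrXn2 (_ : (0 < 2)%N))// ?real_normK ?num_real ?yN// ltW.
  have nd n : 0 <= (d ^+ n)^-1 by rewrite invr_ge0 exprn_ge0// ltW.
  have nc (z : R) : `|cos z| <= 1 by rewrite ler_norml cos_geN1 cos_le1.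
  have ns (z : R) : `|sin z| <= 1 by rewrite ler_norml sin_geN1 sin_le1.
  have pd n (c z : R) : `|z| <= 1 ->
      `|c * (z * s^-1 ^+ n)| <= `|c| * (d ^+ n)^-1.
    move=> z1; rewrite [leLHS]normrM [X in _ * X <= _]normrM ler_wpM2l//.
    by rewrite -[leRHS]mul1r ler_pM.
  have N0i : 0 <= N^-1 by rewrite invr_ge0 ltW.
  have aa : a ^+ 2 <= a by rewrite expr2 ler_piMl.
  have aaN : a ^+ 2 * N <= a by rewrite expr2 -mulrA ler_piMr.
  rewrite (le_trans (ler_normD _ _))// !mulrDr lerD//.
    rewrite (le_trans (ler_normB _ _))// lerD//.
      rewrite (le_trans (pd _ _ _ (ns _)))// normrN ger0_norm ?mulr_ge0//.
      by rewrite [leRHS]mulrA [a * 8]mulrC.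
    rewrite (le_trans (pd _ _ _ (nc _)))// [`|_ * y|]normrM yN'.
    rewrite ger0_norm ?mulr_ge0 ?sqr_ge0// [leRHS]mulrA ler_wpM2r//; lra.
  rewrite (le_trans (pd _ _ _ (ns _)))// ger0_norm ?mulr_ge0 ?sqr_ge0//.
  rewrite [leRHS]mulrA ler_wpM2r//; lra.
rewrite (le_trans (ler_normB _ _))//.
rewrite [leRHS](_ : _ = a * (8 / d ^+ 3 + 24 / d ^+ 4 + 24 / d ^+ 5)
  + a * (8 / d ^+ 3 + 24 / d ^+ 4 + 24 / d ^+ 5)); last by ring.
by rewrite lerD// B ?sqrrN.
Qed.

Lemma rintegrable_bump_cos N s b : 0 < N ->
  rintegrable leb (fun x => bump N x * cos (s * x + b)).
Proof.
move=> N0; apply: (@rintegrable_bounded _ _ N 1).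
  apply: measurable_funM; first exact: measurable_bump.
  apply: measurableT_comp.
    by apply: continuous_measurable_fun; exact: continuous_cos.
  by apply: measurable_funD => //; exact: measurable_funM.
move=> x; have /andP[b0 b1] := bump_le x N0.
rewrite normrM mul1r ger0_norm// (le_trans _ b1)// ler_piMr//.
by rewrite ler_norml cos_geN1 cos_le1.
Qed.

Definition bump2 N (x : T2) : R := bump N x.1 * bump N x.2.

Lemma measurable_bump2 N : measurable_fun setT (bump2 N).
Proof.
apply: measurable_funM.
  by apply: (measurableT_comp (measurable_bump N)).
by apply: (measurableT_comp (measurable_bump N)).
Qed.

Lemma bump2_le N x y : 0 < N -> 0 <= bump2 N (x, y) <= ind N x * ind N y.
Proof.
move=> N0; have /andP[? ?] := bump_le x N0; have /andP[? ?] := bump_le y N0.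
by rewrite /bump2/= mulr_ge0// ler_pM.
Qed.

(** The coordinate in which the frequency is separated from 0 contributes N^-2, the other one at
    most the length 2 N; the product still tends to 0. *)
Lemma bump2_cos N (s : R * R) b d : 1 <= N -> 0 < d ->
  d <= `|s.1| \/ d <= `|s.2| ->
  `|\int[area R]_x (bump2 N x * cos (dot2 x s + b))| <=
  4 * N^-1 * (8 / d ^+ 3 + 24 / d ^+ 4 + 24 / d ^+ 5).
Proof.
move=> N1 d0; set C := (X in _ <= _ * X) => ds.
have N0 : 0 < N by lra.
have b1 x : 0 <= bump N x <= 1.
  have /andP[-> h] := bump_le x N0; rewrite (le_trans h)//.
  by rewrite /ind indicE lern1 leq_b1.
have -> : 4 * N^-1 * C = 2 * N * (2 * N^-1 ^+ 2 * C) by field; rewrite gt_eqF.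
have mF : measurable_fun setT
    (fun x : T2 => bump2 N x * cos (dot2 x s + b)).
  apply: measurable_funM; first exact: measurable_bump2.
  apply: measurableT_comp.
    by apply: continuous_measurable_fun; exact: continuous_cos.
  by apply: measurable_funD => //; exact: measurable_dot2r.
have Fb x y : `|bump2 N (x, y) * cos (dot2 (x, y) s + b)| <=
    1 * (ind N x * ind N y).
  have /andP[h0 h1] := bump2_le x y N0.
  rewrite normrM mul1r ger0_norm// (le_trans _ h1)// ler_piMr//.
  by rewrite ler_norml cos_geN1 cos_le1.
have step x s' b' : d <= `|s'| ->
    `|\int[leb]_y (bump N x * (bump N y * cos (s' * y + b')))| <=
    2 * N^-1 ^+ 2 * C.
  move=> ds'; rewrite RintegralZl//; last exact: rintegrable_bump_cos.
  have /andP[? ?] := b1 x.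
  rewrite normrM -[leRHS]mul1r; apply: ler_pM => //; first by rewrite ger0_norm.
  exact: bump_cos.
case: ds => ds.
- apply: (Rintegral_area2 _ mF Fb) => [|y]; first exact: ltW.
  rewrite (le_trans _ (step y _ (y * s.2 + b) ds))//.
  rewrite le_eqVlt; apply/orP; left; apply/eqP; congr (`| _ |).
  apply: eq_Rintegral => x _; rewrite /bump2 /dot2/= addrA [x * _]mulrC.
  by ring.
- apply: (Rintegral_area1 _ mF Fb) => [|x]; first exact: ltW.
  rewrite (le_trans _ (step x _ (x * s.1 + b) ds))//.
  rewrite le_eqVlt; apply/orP; left; apply/eqP; congr (`| _ |).
  apply: eq_Rintegral => y _; rewrite /bump2 /dot2/= [in RHS]addrA.
  by rewrite [s.2 * y + _]addrC [s.2 * y]mulrC mulrA.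
Qed.

End bump.

(** * Vanishing of the transform of w off the support of g *)

Section support.
Context {R : realType}.
Local Notation T2 := (measurableTypeR R * measurableTypeR R)%type.
Local Notation P := (area R).
Implicit Types f g w : T2 -> R[i].

(* Multiplying w by wide bumps turns its Fourier transform into an average of
   g with weights concentrated near xi. *)
Lemma ft_ft_support g w (c : R[i]) (xi : T2) (d : R) : 0 < d ->
  cintegrable P g -> cintegrable P w ->
  {ae P, forall x, c * ft 1 g x = w x} ->
  (forall eta, g eta != 0 -> d <= `|eta.1 - xi.1| \/ d <= `|eta.2 - xi.2|) ->
  ft (-1) w xi = 0.
Proof.
move=> d0 ig iw gw gd.
have mw := cintegrable_cmeas iw; have mg := cintegrable_cmeas ig.
pose e x := expi (-1 * dot2 x xi).
have me : cmeas e.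
  by apply: cmeas_expi; apply: measurable_funM => //; exact: measurable_dot2r.
pose TT n (x : T2) : R[i] := (bump2 n.+1%:R x)%:C.
have mT n : cmeas (TT n) by apply: cmeas_real; exact: measurable_bump2.
(* [A n] has two limits: the value of the transform of [w] at [xi], since the bumps tend to 1, and
   0, by the multiplication formula and the decay of the transformed bumps on the support of [g]. *)
pose A n := cint P (fun x => TT n x * (e x * w x)).
have iT n : cintegrable P (fun x => TT n x * e x).
  apply: (@le_cintegrable _ _ _ _ _ (bump2 n.+1%:R)).
  - exact: cmeasM.
  - move=> [x y]; have /andP[h0 _] := @bump2_le _ n.+1%:R x y (ltr0Sn _ _).
    by rewrite Normc.normcM normc_expi mulr1 normcE/= expr0n addr0 sqrtr_sqr ger0_norm.
  - apply: (rintegrable_area_bounded (L := n.+1%:R) (M := 1)).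
      exact: measurable_bump2.
    move=> x y; have /andP[h0 h1] := @bump2_le _ n.+1%:R x y (ltr0Sn _ _).
    by rewrite ger0_norm// mul1r.
pose K := 4 * (8 / d ^+ 3 + 24 / d ^+ 4 + 24 / d ^+ 5).
have K0 : 0 <= K by rewrite mulr_ge0// !addr_ge0// divr_ge0// exprn_ge0// ltW.
have small n eta : g eta != 0 -> 
    normc (ft 1 (fun x => TT n x * e x) eta) <= 2 * K * n.+1%:R^-1.
  move=> /gd ds.
  (* [p] is the real or the imaginary part; the shift [b], equal to 0 or -pi/2, reduces both to one
     cosine estimate. *)
  have H (p : R[i] -> R) b : (forall r : R, p (expi r) = cos (r + b)) ->
      (forall (r : R) z, p (r%:C * z) = r * p z) ->
      `|\int[P]_x p (expi (1 * dot2 x eta) * (TT n x * e x))| <= K * n.+1%:R^-1.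
    move=> pe pr.
    have -> : \int[P]_x p (expi (1 * dot2 x eta) * (TT n x * e x)) =
       \int[P]_x (bump2 n.+1%:R x * cos (dot2 x (eta.1 - xi.1, eta.2 - xi.2) + b)).
      apply: eq_Rintegral => x _; rewrite mulrCA pr; congr (_ * _).
      rewrite -pe; congr (p _); rewrite /e /expi mul1r mulN1r.
      have -> : dot2 x (eta.1 - xi.1, eta.2 - xi.2) = dot2 x eta - dot2 x xi.
        by rewrite /dot2/=; ring.
      apply/eqP; rewrite eq_complex/= cosB sinB cosN sinN.
      by apply/andP; split; apply/eqP; ring.
    have N1 : 1 <= n.+1%:R :> R by rewrite ler1n.
    apply: (le_trans (@bump2_cos _ _ (eta.1 - xi.1, eta.2 - xi.2) b d N1 d0 ds)).
    by rewrite /K mulrAC.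
  rewrite (le_trans (normc_le_ReIm _))// -mulrA mulr_natl mulr2n lerD//.
    refine (H (@complex.Re R) 0 _ _) => [r|r z]; first by rewrite addr0.
    by rewrite Re_mulc/= mul0r subr0.
  refine (H (@complex.Im R) (- (pi / 2)) _ _) => [r|r z]; first by rewrite /= cosB cos_pihalf sin_pihalf mulr0 mulr1 add0r.
  by rewrite Im_mulc/= mul0r addr0.
have AE n : A n = c * cint P (fun eta => g eta * ft 1 (fun x => TT n x * e x) eta).
  rewrite -(ft_multiplication 1 (iT n) ig) -cintZ; last first.
    apply: (@le_cintegrable _ _ _ _ _ (fun x => (2 * \int[P]_x normc (g x)) * normc (TT n x * e x))).
    - by apply: cmeasM; [exact: cmeasM|exact: cmeas_ft].
    - by move=> x; rewrite Normc.normcM mulrC ler_wpM2r ?normc_ge0// normc_ft.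
    - exact/rintegrableZ/cintegrable_normc.
  apply: ae_eq_cint.
  - by apply: cmeasM => //; exact: cmeasM.
  - by apply: cmeasM; [exact: cmeas_cst|apply: cmeasM; [exact: cmeasM|exact: cmeas_ft]].
  by apply: filterS gw => x <-; ring.
pose I := \int[P]_x normc (g x).
have I0 : 0 <= I by apply: Rintegral_ge0 => x _; exact: normc_ge0.
have Abound n : normc (A n) <= normc c * (2 * (2 * K * I)) * n.+1%:R^-1.
  have bnd eta : normc (g eta * ft 1 (fun x => TT n x * e x) eta) <=
     (2 * K * n.+1%:R^-1) * normc (g eta).
    rewrite Normc.normcM mulrC.
    have [->|ge] := eqVneq (g eta) 0; first by rewrite Normc.normc0 !mulr0.
    by rewrite ler_wpM2r ?normc_ge0// small.
  have ib : rintegrable P (fun eta => (2 * K * n.+1%:R^-1) * normc (g eta)).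
    exact/rintegrableZ/cintegrable_normc.
  have iG : cintegrable P (fun eta => g eta * ft 1 (fun x => TT n x * e x) eta).
    apply: le_cintegrable bnd ib.
    by apply: cmeasM => //; apply: cmeas_ft; exact: cmeasM.
  rewrite AE Normc.normcM.
  rewrite [leRHS](_ : _ = normc c * (2 * (2 * K * I * n.+1%:R^-1))); last by ring.
  rewrite ler_wpM2l ?normc_ge0// (le_trans (normc_cint iG))// ler_wpM2l//.
  apply: (le_trans (le_rint (cintegrable_normc iG) ib bnd)).
  by rewrite RintegralZl//; [rewrite -/I mulrAC|exact: cintegrable_normc].
have invn0 : (n.+1%:R^-1 : R) @[n --> \oo] --> (0 : R).
  exact: cvg_harmonic.
have lim0 (p : R[i] -> R) : (forall z, `|p z| <= normc z) ->
    (fun n => p (A n)) @ \oo --> (0 : R).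
  move=> pn; apply/norm_cvg0P.
  apply: (@squeeze_cvgr _ _ _ _ (fun=> 0) (fun n => normc c * (2 * (2 * K * I)) * n.+1%:R^-1)).
  - by apply: nearW => n; rewrite normr_ge0/= (le_trans (pn _)).
  - exact: cvg_cst.
  - by rewrite -[X in _ --> X](mulr0 (normc c * (2 * (2 * K * I)))); apply: cvgM => //; exact: cvg_cst.
have limW (p : R[i] -> R) : (forall z, `|p z| <= normc z) ->
    (forall h : T2 -> R[i], cmeas h -> measurable_fun setT (fun x => p (h x))) ->
    (forall (r : R) z, p (r%:C * z) = r * p z) ->
    (fun n => \int[P]_x p (TT n x * (e x * w x))) @ \oo -->
    \int[P]_x p (e x * w x).
  move=> pn mp pr.
  apply: (@dominated_Rintegral _ _ _ P _ _ (fun x => normc (w x))).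
  - move=> n; apply: (mp (fun x => TT n x * (e x * w x))).
    by apply: cmeasM => //; exact: cmeasM.
  - by apply: (mp (fun x => e x * w x)); exact: cmeasM.
  - apply: aeW => -[x y].
    suff : (bump2 n.+1%:R (x, y) * p (e (x, y) * w (x, y))) @[n --> \oo] -->
        1 * p (e (x, y) * w (x, y)).
      by rewrite mul1r; under eq_fun do rewrite -pr.
    apply: cvgM; last exact: cvg_cst.
    have cb (z : R) : (bump n.+1%:R z : R) @[n --> \oo] --> (1 : R).
      have lim2 (u : nat -> R) (l : R) : u @ \oo --> l -> (u n ^+ 2) @[n --> \oo] --> l ^+ 2.
        by move=> ul; rewrite expr2; under eq_fun do rewrite expr2; exact: cvgM.
      have : ((1 - n.+1%:R^-1 ^+ 2 * z ^+ 2) ^+ 2) @[n --> \oo] --> (1 - 0 ^+ 2 * z ^+ 2) ^+ 2.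
        apply: (lim2 (fun n => 1 - n.+1%:R^-1 ^+ 2 * z ^+ 2)).
        apply: cvgB; first exact: cvg_cst.
        by apply: cvgM; [exact: lim2|exact: cvg_cst].
      have -> : (1 - 0 ^+ 2 * z ^+ 2) ^+ 2 = 1 :> R by ring.
      apply: cvg_trans; apply: near_eq_cvg; near=> n.
      rewrite /bump ind_in ?mul1r//.
      rewrite (@le_trans _ _ n%:R)// ?ler_nat//; near: n; exact: nbhs_infty_ger.
    have := cvgM (cb x) (cb y); rewrite mulr1; exact.
  - exact: cintegrable_normc.
  - move=> n [x y]; rewrite pr normrM.
    have /andP[h0 h1] := @bump2_le _ n.+1%:R x y (ltr0Sn _ _).
    have hb : `|bump2 n.+1%:R (x, y)| <= 1.
      rewrite ger0_norm// (le_trans h1)// /ind !indicE -natrM mulnb lern1.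
      by rewrite leq_b1.
    by rewrite -[leRHS]mul1r ler_pM// (le_trans (pn _))// normc_expiM.
apply/eqP; rewrite eq_complex; apply/andP; split; apply/eqP.
- apply: (cvg_unique _ (limW _ (@Re_le_normc _) (fun h mh => mh.1) _)) => //.
  + by move=> r z; rewrite Re_mulc/= mul0r subr0.
  + exact: (lim0 _ (@Re_le_normc _)).
- apply: (cvg_unique _ (limW _ (@Im_le_normc _) (fun h mh => mh.2) _)) => //.
  + by move=> r z; rewrite Im_mulc/= mul0r addr0.
  + exact: (lim0 _ (@Im_le_normc _)).
Unshelve. all: by end_near. Qed.

End support.

(** * The set where the phase is almost stationary *)

Section sublevel.
Context {R : realType}.
Local Notation T2 := (measurableTypeR R * measurableTypeR R)%type.
Local Notation leb := (@lebesgue_measure R).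

Lemma le_norm_Rintegral d (T : measurableType d)
    (mu : {measure set T -> \bar R}) (f g : T -> R) :
  measurable_fun setT f -> rintegrable mu g -> (forall x, `|f x| <= g x) ->
  `|\int[mu]_x f x| <= \int[mu]_x g x.
Proof.
move=> mf ig fg; have if_ := le_rintegrable mf fg ig.
rewrite (le_trans (le_normr_Rintegral _ _))//.
by apply: le_rint => //; exact: rintegrable_norm.
Qed.

Lemma measurable_invr d (T : measurableType d) (f : T -> R) :
  (forall x, 0 <= f x) -> measurable_fun setT f ->
  measurable_fun setT (fun x => (f x)^-1).
Proof.
move=> f0 mf; under eq_fun do rewrite -powR_inv1//.
by apply: (measurableT_comp (measurable_powR (-1))).
Qed.

(** The primitive atan(al y + be) / al oscillates by at most pi / |al|, whatever [be] and [L]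
    are. *)
Lemma Rintegral_atan (al be L : R) : 0 < L -> al != 0 ->
  \int[leb]_y (ind L y * (1 + (al * y + be) ^+ 2)^-1) <= pi / `|al|.
Proof.
move=> L0 al0.
have pos y : 1 + (al * y + be) ^+ 2 != 0.
  by rewrite gt_eqF// ltr_pwDl// sqr_ge0.
pose h y := (1 + (al * y + be) ^+ 2)^-1.
pose H y := atan (al * y + be) / al.
have dH (y : R) : is_derive y 1 H (h y).
  by rewrite /H /h; der; field; rewrite al0 pos.
have ch : continuous h.
  move=> y; have : is_derive y 1 h
    (- (2 * (al * y + be) * al) / (1 + (al * y + be) ^+ 2) ^+ 2).
    by rewrite /h; der; [exact: pos|field].
  exact: is_derive_continuous.
have -> := Rintegral_FTC L0 ch dH (fun=> erefl).
rewrite -mulrBl (le_trans (ler_norm _))// normrM normfV.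
rewrite ler_wpM2r ?invr_ge0//.
have := atan_gtNpi2 (al * L + be); have := atan_ltpi2 (al * L + be).
have := atan_gtNpi2 (al * - L + be); have := atan_ltpi2 (al * - L + be).
move: (atan _) (atan _) => u v h1 h2 h3 h4.
by rewrite ler_norml; apply/andP; split; lra.
Qed.

Lemma measurable_sqn (z : T2 -> R) : measurable_fun setT z ->
  measurable_fun setT (fun x => z x ^+ 2).
Proof. by move=> ?; exact: measurable_funX. Qed.

Definition rho2 (x : T2) : R := x.1 ^+ 2 + x.2 ^+ 2.

Lemma measurable_rho2 : measurable_fun setT rho2.
Proof. by apply: measurable_funD; apply: measurable_funX. Qed.

Lemma measurable_comp_rho2 (f : R -> R) : measurable_fun setT f ->
  measurable_fun setT (fun x => f (rho2 x)).
Proof. by move=> mf; apply: (measurableT_comp mf); exact: measurable_rho2. Qed.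

Variables (nu : R -> R) (a L n0 : R).
Hypotheses (a0 : 0 < a) (a1 : a <= 1) (L0 : 0 < L) (n00 : 0 < n0).
Hypothesis mnu : measurable_fun setT nu.
Hypothesis nu_ge : forall s, a <= s <= L ^+ 2 -> n0 <= `|nu s|.

(** The gradient of z.x - t mu(|x|^2) for nu = 2 mu', the radial part having gradient 2 mu'(|x|^2)
    x. *)
Definition grad1 (t z1 : R) (x : T2) : R := z1 - t * nu (rho2 x) * x.1.
Definition grad2 (t z2 : R) (x : T2) : R := z2 - t * nu (rho2 x) * x.2.

Lemma measurable_grad1 t z : measurable_fun setT (grad1 t z).
Proof.
apply: measurable_funB => //; apply: measurable_funM => //.
by apply: measurable_funM => //; exact: measurable_comp_rho2.
Qed.

Lemma measurable_grad2 t z : measurable_fun setT (grad2 t z).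
Proof.
apply: measurable_funB => //; apply: measurable_funM => //.
by apply: measurable_funM => //; exact: measurable_comp_rho2.
Qed.

Definition den (t z1 z2 : R) (x : T2) : R :=
  `|t| + grad1 t z1 x ^+ 2 + grad2 t z2 x ^+ 2.

Lemma measurable_den t z1 z2 : measurable_fun setT (den t z1 z2).
Proof.
apply: measurable_funD; last by apply: measurable_sqn; exact: measurable_grad2.
by apply: measurable_funD => //; apply: measurable_sqn; exact: measurable_grad1.
Qed.

Lemma den_gt0 t z1 z2 x : t != 0 -> 0 < den t z1 z2 x.
Proof. by move=> t0; rewrite /den -addrA ltr_pwDl ?normr_gt0// addr_ge0 ?sqr_ge0. Qed.

Definition annulus : R -> R := \1_(`[a, L ^+ 2]%classic).

Lemma annulus_ind s : 0 <= annulus s <= 1.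
Proof. by rewrite /annulus indicE ler0n lern1 leq_b1. Qed.

Lemma annulus_in s : a <= s <= L ^+ 2 -> annulus s = 1.
Proof. by move=> h; rewrite /annulus indicE mem_set//= in_itv/=. Qed.

Lemma annulus_out s : ~ (a <= s <= L ^+ 2) -> annulus s = 0.
Proof. by move=> h; rewrite /annulus indicE memNset//= in_itv/=. Qed.

Lemma measurable_annulus : measurable_fun setT annulus.
Proof. exact: measurable_indic. Qed.

Lemma annulus_box x : annulus (rho2 x) <= ind L x.1 * ind L x.2.
Proof.
have [h|h] := pselect (a <= rho2 x <= L ^+ 2); last first.
  by rewrite annulus_out// mulr_ge0// ind_ge0.
have H (y : R) : y ^+ 2 <= L ^+ 2 -> `|y| <= L.
  by move=> yL; rewrite -ler_sqr ?nnegrE ?(ltW L0)// real_normK ?num_real.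
have /andP[_ hL] := h; rewrite !ind_in ?mulr1.
- by have /andP[] := annulus_ind (rho2 x).
- by apply: H; rewrite (le_trans _ hL)// lerDr sqr_ge0.
- by apply: H; rewrite (le_trans _ hL)// lerDl sqr_ge0.
Qed.

(** A soft form of the indicator of the set where the gradient of the phase is at most |t|^(1/2),
    restricted to the annulus. *)
Definition weight (t z1 z2 : R) (x : T2) : R :=
  `|t| / den t z1 z2 x * annulus (rho2 x).

Lemma measurable_weight t z1 z2 : t != 0 -> measurable_fun setT (weight t z1 z2).
Proof.
move=> t0; apply: measurable_funM.
  apply: measurable_funM => //; apply: measurable_invr.
    by move=> x; rewrite ltW// den_gt0.
  exact: measurable_den.
by apply: measurable_comp_rho2; exact: measurable_annulus.
Qed.

Lemma weight_ge0 t z1 z2 x : t != 0 -> 0 <= weight t z1 z2 x.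
Proof.
by move=> t0; rewrite /weight mulr_ge0// ?divr_ge0// ?ltW ?den_gt0//.
Qed.

Lemma weight_le1 t z1 z2 x : t != 0 -> weight t z1 z2 x <= annulus (rho2 x).
Proof.
move=> t0; rewrite /weight ler_piMl//.
rewrite ler_pdivrMr ?den_gt0// mul1r /den -addrA lerDl addr_ge0// sqr_ge0//.
Qed.

(** The threshold for z being small compared with t. On the annulus the radial part of the gradient
    has square at least n0^2 a t^2, which is at least 16 kap^2 t^2 because a <= 1; this dominates z
    when both its components are at most kap |t|. *)
Let kap := n0 * a / 4.

Let kap0 : 0 < kap. Proof. by rewrite divr_gt0// mulr_gt0. Qed.

(* [grad1 * x.2 - grad2 * x.1 = z1 * x.2 - z2 * x.1]: the phase is rotation
   invariant up to its linear part. *)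
Lemma weight_tangential t z1 z2 x : t != 0 ->
  weight t z1 z2 x <=
  (1 + ((z1 * x.2 - z2 * x.1) / (L * Num.sqrt `|t|)) ^+ 2)^-1.
Proof.
move=> t0; set T := `|t|; have T0 : 0 < T by rewrite normr_gt0.
set r := Num.sqrt T; have r2 : r ^+ 2 = T by rewrite sqr_sqrtr// ltW.
have r0 : 0 < r by rewrite sqrtr_gt0.
set w := z1 * x.2 - z2 * x.1.
have pos : 0 < 1 + (w / (L * r)) ^+ 2 by rewrite ltr_pwDl// sqr_ge0.
have [h|h] := pselect (a <= rho2 x <= L ^+ 2); last first.
  by rewrite /weight annulus_out// mulr0 invr_ge0 ltW.
have /andP[_ hL] := h.
rewrite /weight annulus_in// mulr1 ler_pdivrMr ?den_gt0//.
rewrite mulrC ler_pdivlMr// /den -/T.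
set p := grad1 t z1 x; set q := grad2 t z2 x.
have wE : w = p * x.2 - q * x.1 by rewrite /w /p /q /grad1 /grad2; ring.
have w2 : w ^+ 2 <= (p ^+ 2 + q ^+ 2) * L ^+ 2.
  rewrite (@le_trans _ _ ((p ^+ 2 + q ^+ 2) * rho2 x))//.
    (* Lagrange's identity, which gives the Cauchy-Schwarz inequality with its explicit
       remainder. *)
    rewrite wE -subr_ge0 (_ : _ - _ = (p * x.1 + q * x.2) ^+ 2) ?sqr_ge0//.
    by rewrite /rho2; ring.
  by rewrite ler_wpM2l// addr_ge0 ?sqr_ge0.
rewrite mulrDr mulr1 -addrA lerD2l.
have -> : T * (w / (L * r)) ^+ 2 = w ^+ 2 / L ^+ 2.
  by rewrite -r2; field; rewrite !gt_eqF.
by rewrite ler_pdivrMr// exprn_gt0.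
Qed.

(** For small z the squared gradient is at least kap^2 t^2, and |t| + kap^2 t^2 >= 2 kap |t|^(3/2)
    by the arithmetic-geometric mean inequality. *)
Lemma weight_radial t z1 z2 x : t != 0 ->
  `|z1| <= kap * `|t| -> `|z2| <= kap * `|t| ->
  weight t z1 z2 x <= (2 * kap * Num.sqrt `|t|)^-1.
Proof.
move=> t0; set T := `|t|; have T0 : 0 < T by rewrite normr_gt0.
set r := Num.sqrt T; have r2 : r ^+ 2 = T by rewrite sqr_sqrtr// ltW.
have r0 : 0 < r by rewrite sqrtr_gt0.
move=> hz1 hz2.
have [h|h] := pselect (a <= rho2 x <= L ^+ 2); last first.
  by rewrite /weight annulus_out// mulr0 invr_ge0 !mulr_ge0// ltW.
have /andP[ha _] := h; have hn := nu_ge h.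
rewrite /weight annulus_in// mulr1 ler_pdivrMr ?den_gt0// mulrC.
rewrite ler_pdivlMr ?mulr_gt0// /den -/T.
set p := grad1 t z1 x; set q := grad2 t z2 x.
pose n := t * nu (rho2 x).
have n2 : n0 ^+ 2 * T ^+ 2 <= n ^+ 2.
  rewrite -exprMn -[n ^+ 2]real_normK ?num_real// lerXn2r ?nnegrE//.
    exact: mulr_ge0 (ltW n00) (ltW T0).
  by rewrite /n normrM mulrC; apply: ler_wpM2l => //; exact: ltW.
have sq (z : R) : `|z| <= kap * T -> z ^+ 2 <= kap ^+ 2 * T ^+ 2.
  move=> hz; rewrite -exprMn -[z ^+ 2]real_normK ?num_real// lerXn2r ?nnegrE//.
  by rewrite mulr_ge0// ltW.
have s1 := sq _ hz1; have s2 := sq _ hz2.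
(* Since [n * x.1 = z1 - p], this is (u - v)^2 <= 2 u^2 + 2 v^2. *)
have e1 : (n * x.1) ^+ 2 <= 2 * p ^+ 2 + 2 * z1 ^+ 2.
  rewrite -subr_ge0 (_ : _ - _ = (p + z1) ^+ 2) ?sqr_ge0//.
  by rewrite /p /grad1 -/n; ring.
have e2 : (n * x.2) ^+ 2 <= 2 * q ^+ 2 + 2 * z2 ^+ 2.
  rewrite -subr_ge0 (_ : _ - _ = (q + z2) ^+ 2) ?sqr_ge0//.
  by rewrite /q /grad2 -/n; ring.
have e3 : n ^+ 2 * a <= n ^+ 2 * rho2 x by rewrite ler_wpM2l ?sqr_ge0.
have e3' : n ^+ 2 * rho2 x = (n * x.1) ^+ 2 + (n * x.2) ^+ 2.
  by rewrite /rho2; ring.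
have e4 : n0 ^+ 2 * T ^+ 2 * a <= n ^+ 2 * a by rewrite ler_wpM2r// ltW.
have kE : n0 * a = 4 * kap by rewrite /kap; field.
have e5 : 16 * (kap ^+ 2 * T ^+ 2) <= n0 ^+ 2 * T ^+ 2 * a.
  have -> : 16 * (kap ^+ 2 * T ^+ 2) = (n0 ^+ 2 * T ^+ 2 * a) * a.
    by rewrite /kap; field.
  by rewrite ler_piMr// !mulr_ge0// ?sqr_ge0// ltW.
have e6 : kap ^+ 2 * T ^+ 2 <= p ^+ 2 + q ^+ 2.
  have : 0 <= kap ^+ 2 * T ^+ 2 by rewrite mulr_ge0 ?sqr_ge0.
  by lra.
have e7 : T * (2 * kap * r) <= T + kap ^+ 2 * T ^+ 2.
  rewrite -subr_ge0 (_ : _ - _ = r ^+ 2 * (1 - kap * r) ^+ 2).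
    by rewrite mulr_ge0 ?sqr_ge0.
  by rewrite -r2; ring.
lra.
Qed.

Lemma weight_box t z1 z2 x y : t != 0 ->
  `|weight t z1 z2 (x, y)| <= 1 * (ind L x * ind L y).
Proof.
move=> t0; rewrite ger0_norm ?weight_ge0// mul1r.
by rewrite (le_trans (weight_le1 _ _ _ t0))// (annulus_box (x, y)).
Qed.

Lemma weight_slice (al be : R) (f : R -> R) : al != 0 -> measurable_fun setT f ->
  (forall y, `|f y| <= 1 * ind L y) ->
  (forall y, `|f y| <= (1 + (al * y + be) ^+ 2)^-1) ->
  `|\int[leb]_y f y| <= pi / `|al|.
Proof.
move=> al0 mf f1 f2; apply: le_trans (Rintegral_atan be L0 al0).
apply: le_norm_Rintegral => //.
  apply: (@rintegrable_bounded _ _ L 1).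
    apply: measurable_funM; first exact: measurable_ind.
    apply: measurable_invr.
      by move=> y; rewrite addr_ge0 ?sqr_ge0.
    apply: measurable_funD => //; apply: measurable_funX.
    by apply: measurable_funD => //; exact: measurable_funM.
  move=> y; rewrite ger0_norm ?mulr_ge0 ?ind_ge0 ?invr_ge0 ?addr_ge0 ?sqr_ge0//.
  rewrite mul1r ler_piMr ?ind_ge0// invf_le1 ?lerDl ?sqr_ge0//.
  by rewrite ltr_pwDl// sqr_ge0.
move=> y; have [yL|yL] := leP `|y| L; first by rewrite ind_in// mul1r.
by rewrite (le_trans (f1 y))// ind_out// mulr0 mul0r.
Qed.

(** If |z1| > kap |t|, the tangential bound is integrated in [x.2], whose coefficient is z1; if |z2|
    > kap |t|, in [x.1]; otherwise the radial bound holds pointwise. In 2 + 2 pi the summand 2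
    covers the last case ([B1]) and 2 pi the arctangent cases ([B2]). *)
Lemma Rintegral_weight t z1 z2 : t != 0 ->
  `|\int[area R]_x weight t z1 z2 x| <=
  L ^+ 2 * (2 + 2 * pi) / kap / Num.sqrt `|t|.
Proof.
move=> t0; set T := `|t|; have T0 : 0 < T by rewrite normr_gt0.
set r := Num.sqrt T; have r2 : r ^+ 2 = T by rewrite sqr_sqrtr// ltW.
have r0 : 0 < r by rewrite sqrtr_gt0.
have L0' := ltW L0.
have mS := measurable_weight z1 z2 t0.
have bS x y := weight_box z1 z2 x y t0.
have p0 := pi_ge0 R.
have B1 : 2 * L * (2 * L * (2 * kap * r)^-1) <= L ^+ 2 * (2 + 2 * pi) / kap / r.
  rewrite -subr_ge0 (_ : _ - _ = L ^+ 2 * (2 * pi) / kap / r).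
    by rewrite !divr_ge0 ?mulr_ge0 ?sqr_ge0 // ltW.
  by field; rewrite !gt_eqF.
have B2 (z : R) : kap * T < `|z| -> z / (L * r) != 0 /\
    2 * L * (pi / `|z / (L * r)|) <= L ^+ 2 * (2 + 2 * pi) / kap / r.
  move=> hz; have z0 : 0 < `|z| by apply: le_lt_trans hz; rewrite mulr_ge0// ltW.
  split; first by rewrite mulf_neq0 -?normr_gt0// normr_gt0 invr_eq0 mulf_neq0// gt_eqF.
  have -> : `|z / (L * r)| = `|z| / (L * r).
    by rewrite normrM normfV [`|L * r|]ger0_norm// mulr_ge0// ltW.
  rewrite (_ : 2 * L * _ = (2 * L ^+ 2 * pi * r) / `|z|); last first.
    by field; rewrite !gt_eqF.
  rewrite ler_pdivrMr//.
  apply: (@le_trans _ _ (L ^+ 2 * (2 + 2 * pi) / kap / r * (kap * T))); last first.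
    by rewrite ler_wpM2l ?(ltW hz)// !divr_ge0 ?mulr_ge0 ?addr_ge0 ?sqr_ge0// ?mulr_ge0// ltW.
  rewrite -r2 (_ : _ * (kap * r ^+ 2) = L ^+ 2 * (2 + 2 * pi) * r); last first.
    by field; rewrite !gt_eqF.
  rewrite ler_wpM2r ?(ltW r0)// [leLHS](_ : _ = L ^+ 2 * (2 * pi)); last by ring.
  by rewrite ler_wpM2l ?sqr_ge0// lerDr.
have [hz1|hz1] := ltP (kap * T) `|z1|.
  have [al0 B] := B2 _ hz1; apply: le_trans B.
  apply: (Rintegral_area1 L0' mS bS) => x.
  apply: (@weight_slice _ (- (z2 * x / (L * r)))) => //.
  - by apply: measurableT_comp mS _ => //.
  - move=> y; rewrite (le_trans (bS x y))// !mul1r ler_piMl ?ind_ge0//.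
    by rewrite /ind indicE lern1 leq_b1.
  - move=> y; rewrite ger0_norm ?weight_ge0// (le_trans (weight_tangential _ _ _ t0))//.
    rewrite le_eqVlt; apply/orP; left; apply/eqP; congr (1 + _ ^+ 2)^-1.
    by rewrite mulrBl/= mulrAC.
have [hz2|hz2] := ltP (kap * T) `|z2|.
  have [al0 B] := B2 _ hz2; apply: le_trans B.
  apply: (Rintegral_area2 L0' mS bS) => y.
  apply: (@weight_slice _ (- (z1 * y / (L * r)))) => //.
  - by apply: measurableT_comp mS _ => //.
  - move=> x; rewrite (le_trans (bS x y))// !mul1r ler_piMr ?ind_ge0//.
    by rewrite /ind indicE lern1 leq_b1.
  - move=> x; rewrite ger0_norm ?weight_ge0// (le_trans (weight_tangential _ _ _ t0))//.
    rewrite le_eqVlt; apply/orP; left; apply/eqP; congr (1 + _)^-1.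
    by rewrite -sqrrN -mulNr opprB mulrBl/= mulrAC.
apply: le_trans B1; apply: (Rintegral_area1 L0' mS bS) => x.
apply: Rintegral_bounded => //; first by apply: measurableT_comp mS _ => //.
move=> y; have [yL|yL] := leP `|y| L.
  by rewrite [ind _ _]ind_in// mulr1 ger0_norm ?weight_ge0// weight_radial.
by rewrite (le_trans (bS x y))// [ind L y]ind_out// !mulr0.
Qed.

End sublevel.

(** * The oscillatory integral *)

Section continuity_rules.
Context {R : realType}.
Implicit Types (f g : R -> R) (x : R).

Lemma cont_cst (c : R) x : {for x, continuous ((fun=> c) : R -> R)}.
Proof. exact: cvg_cst. Qed.

Lemma cont_add f g x : {for x, continuous f} -> {for x, continuous g} ->
  {for x, continuous (fun y => f y + g y)}.
Proof. by move=> cf cg; apply: cvgD. Qed.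

Lemma cont_sub f g x : {for x, continuous f} -> {for x, continuous g} ->
  {for x, continuous (fun y => f y - g y)}.
Proof. by move=> cf cg; apply: cvgB. Qed.

Lemma cont_opp f x : {for x, continuous f} -> {for x, continuous (fun y => - f y)}.
Proof. by move=> cf; apply: cvgN. Qed.

Lemma cont_mul f g x : {for x, continuous f} -> {for x, continuous g} ->
  {for x, continuous (fun y => f y * g y)}.
Proof. by move=> cf cg; apply: cvgM. Qed.

Lemma cont_inv f x : f x != 0 -> {for x, continuous f} ->
  {for x, continuous (fun y => (f y)^-1)}.
Proof. by move=> fx cf; apply: cvgV. Qed.

Lemma cont_comp (f g : R -> R) x : {for g x, continuous f} ->
  {for x, continuous g} -> {for x, continuous (fun y => f (g y))}.
Proof. by move=> cf cg; exact: continuous_comp. Qed.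

Lemma cont_sin f x : {for x, continuous f} -> {for x, continuous (fun y => sin (f y))}.
Proof. by move=> cf; apply: cont_comp => //; exact: continuous_sin. Qed.

Lemma cont_cos f x : {for x, continuous f} -> {for x, continuous (fun y => cos (f y))}.
Proof. by move=> cf; apply: cont_comp => //; exact: continuous_cos. Qed.

Lemma cont_id x : {for x, continuous ((fun y => y) : R -> R)}.
Proof. exact: cvg_id. Qed.

Lemma near_eq_continuous f g x : (\near x, f x = g x) ->
  {for x, continuous f} -> {for x, continuous g}.
Proof.
move=> fg cf; rewrite /prop_for /continuous_at -(nbhs_singleton fg).
by apply: cvg_trans cf; apply: near_eq_cvg; apply: filterS fg => y ->.
Qed.

End continuity_rules.

Section oscillatory.
Context {R : realType}.
Local Notation T2 := (measurableTypeR R * measurableTypeR R)%type.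
Local Notation leb := (@lebesgue_measure R).

(** All functions are of s = |xi|^2: [mu] is the dispersion relation, nu = 2 mu', nu1 = nu', and
    [chi] is the cutoff. The numerical bounds are fixed before t and z are introduced, so the
    resulting estimate is uniform in these. *)
Variables (mu nu nu1 chi chi1 : R -> R) (a L n0 n1 m1 k1 : R).
Hypotheses (a0 : 0 < a) (a1 : a <= 1) (L0 : 0 < L) (n00 : 0 < n0).
Hypotheses (mmu : measurable_fun setT mu) (mnu : measurable_fun setT nu).
Hypothesis mnu1 : measurable_fun setT nu1.
Hypothesis aL : a <= L ^+ 2.
Hypothesis dmu : forall s : R, 0 < s -> is_derive s 1 mu (nu s / 2).
Hypothesis dnu : forall s : R, 0 < s -> is_derive s 1 nu (nu1 s).
Hypothesis cnu1 : forall s : R, 0 < s -> {for s, continuous nu1}.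
Hypothesis nu_ge : forall s, a <= s <= L ^+ 2 -> n0 <= `|nu s|.
Hypothesis nu_le : forall s, a <= s <= L ^+ 2 -> `|nu s| <= n1.
Hypothesis nu1_le : forall s, a <= s <= L ^+ 2 -> `|nu1 s| <= m1.
Hypothesis dchi : forall s : R, is_derive s 1 chi (chi1 s).
Hypothesis cchi1 : continuous chi1.
Hypothesis chi_out : forall s, s < a \/ L ^+ 2 <= s -> chi s = 0.
Hypothesis chi1_out : forall s, s < a \/ L ^+ 2 <= s -> chi1 s = 0.
Hypothesis chi_le : forall s, `|chi s| <= 1.
Hypothesis chi1_le : forall s, `|chi1 s| <= k1.

Section fixed_parameters.
Variables (t b : R).
Hypothesis t0 : t != 0.

(** The constant [b] is there so that the real and the imaginary part of the kernel are instances of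
    one cosine integral. *)
Definition phase (z1 z2 : R) (x : T2) : R :=
  z1 * x.1 + z2 * x.2 - t * mu (rho2 x) + b.

Definition hess11 (x : T2) : R := - t * (nu (rho2 x) + 2 * nu1 (rho2 x) * x.1 ^+ 2).
Definition hess12 (x : T2) : R := - t * (2 * nu1 (rho2 x) * x.1 * x.2).

(* The x.1-derivative of [grad1 * chi / den]. *)
Definition amplitude_deriv (z1 z2 : R) (x : T2) : R :=
  hess11 x * (chi (rho2 x) * (den nu t z1 z2 x)^-1)
  + grad1 nu t z1 x * ((chi1 (rho2 x) * (2 * x.1)) * (den nu t z1 z2 x)^-1)
  - grad1 nu t z1 x * (chi (rho2 x) *
    ((2 * grad1 nu t z1 x * hess11 x + 2 * grad2 nu t z2 x * hess12 x) *
      ((den nu t z1 z2 x)^-1 * (den nu t z1 z2 x)^-1))).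

(* The x.1-derivative of [sin phase * grad1 * chi / den]. *)
Definition flux_deriv (z1 z2 : R) (x : T2) : R :=
  cos (phase z1 z2 x) * (grad1 nu t z1 x * (grad1 nu t z1 x * (chi (rho2 x) * (den nu t z1 z2 x)^-1)))
  + sin (phase z1 z2 x) * amplitude_deriv z1 z2 x.

Lemma rho2_out x y : L < `|x| -> L ^+ 2 <= rho2 (x, y).
Proof.
move=> xL; rewrite /rho2/= -[x ^+ 2]real_normK ?num_real//.
rewrite (@le_trans _ _ (`|x| ^+ 2))// ?lerDl ?sqr_ge0//.
by rewrite lerXn2r ?nnegrE// ltW.
Qed.

Lemma Rintegral_flux_deriv z1 z2 y : \int[leb]_x flux_deriv z1 z2 (x, y) = 0.
Proof.
pose s x := x ^+ 2 + y ^+ 2.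
pose Phi x := phase z1 z2 (x, y).
pose p x := grad1 nu t z1 (x, y). pose q x := grad2 nu t z2 (x, y).
pose D x := den nu t z1 z2 (x, y).
pose F x := sin (Phi x) * (p x * (chi (s x) * (D x)^-1)).
pose h x := flux_deriv z1 z2 (x, y).
(* The line may enter the disc s < a and even hit s = 0, where [mu] is not assumed differentiable.
   There [chi] vanishes and [F] is locally zero; elsewhere s >= a > 0. *)
have near0 (x : R) : s x < a -> \near x, s x < a.
  move=> sxa; have cs : {for x, continuous s}.
    apply: (@is_derive_continuous _ s x (2 * x)).
    by rewrite /s; der; ring.
  exact: (cvgr_lt _ cs _ sxa).
have F0 x : s x < a -> F x = 0.
  by move=> sa; rewrite /F chi_out ?mul0r ?mulr0//; left.
have h0 x : s x < a -> h x = 0.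
  move=> sa; have sa' : rho2 (x, y) < a by [].
  by rewrite /h /flux_deriv /amplitude_deriv chi_out ?chi1_out ?(mul0r,mulr0,addr0,subr0)//; left.
have main (x : R) : 0 < s x -> is_derive x 1 F (h x) /\ {for x, continuous h}.
  move=> sx.
  have ds : is_derive x 1 s (2 * x) by rewrite /s; der; ring.
  have dmus : is_derive x 1 (fun x => mu (s x)) (nu (s x) / 2 * (2 * x)).
    exact: (deriv_comp (dmu sx) ds).
  have dnus : is_derive x 1 (fun x => nu (s x)) (nu1 (s x) * (2 * x)).
    exact: (deriv_comp (dnu sx) ds).
  have dchis : is_derive x 1 (fun x => chi (s x)) (chi1 (s x) * (2 * x)).
    exact: (deriv_comp (dchi _) ds).
  have dPhi : is_derive x 1 Phi (p x).
    have H : is_derive x 1 (fun x => z1 * x + z2 * y - t * mu (s x) + b)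
      (z1 - t * nu (s x) * x) by der; field.
    exact: H.
  have dp : is_derive x 1 p (hess11 (x, y)).
    have H : is_derive x 1 (fun x => z1 - t * nu (s x) * x)
      (- t * (nu (s x) + 2 * nu1 (s x) * x ^+ 2)) by der; ring.
    exact: H.
  have dq : is_derive x 1 q (hess12 (x, y)).
    have H : is_derive x 1 (fun x => z2 - t * nu (s x) * y)
      (- t * (2 * nu1 (s x) * x * y)) by der; ring.
    exact: H.
  have dD : is_derive x 1 D (2 * p x * hess11 (x, y) + 2 * q x * hess12 (x, y)).
    have H : is_derive x 1 (fun x => `|t| + p x ^+ 2 + q x ^+ 2)
      (2 * p x * hess11 (x, y) + 2 * q x * hess12 (x, y)) by der; ring.
    exact: H.
  have Dx : D x != 0 by rewrite gt_eqF// den_gt0.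
  split.
    have H : is_derive x 1 F (cos (Phi x) * (p x * (p x * (chi (s x) * (D x)^-1)))
      + sin (Phi x) * (hess11 (x, y) * (chi (s x) * (D x)^-1)
      + p x * ((chi1 (s x) * (2 * x)) * (D x)^-1)
      - p x * (chi (s x) * ((2 * p x * hess11 (x, y) + 2 * q x * hess12 (x, y)) *
         ((D x)^-1 * (D x)^-1))))).
      rewrite /F; der.
      by move: (cos _) (sin _) (p x) (q x) (chi _) (chi1 _) (hess11 _) (hess12 _) => *; field.
    exact: H.
  have cPhi := is_derive_continuous dPhi.
  have cp := is_derive_continuous dp.
  have cq := is_derive_continuous dq.
  have cD := is_derive_continuous dD.
  have cchis := is_derive_continuous dchis.
  have cnus := is_derive_continuous dnus.
  have cs := is_derive_continuous ds.
  have cnu1s : {for x, continuous (fun x => nu1 (s x))}.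
    by apply: cont_comp cs; exact: cnu1.
  have cchi1s : {for x, continuous (fun x => chi1 (s x))}.
    by apply: cont_comp cs; exact: cchi1.
  have ch11 : {for x, continuous (fun x => hess11 (x, y))}.
    refine (cont_mul (@cont_cst R (- t) x) (cont_add cnus
      (cont_mul (cont_mul (@cont_cst R 2 x) cnu1s) (cont_mul (@cont_id R x) (@cont_id R x))))).
  have ch12 : {for x, continuous (fun x => hess12 (x, y))}.
    refine (cont_mul (@cont_cst R (- t) x)
      (cont_mul (cont_mul (cont_mul (@cont_cst R 2 x) cnu1s) (@cont_id R x)) (@cont_cst R y x))).
  have cDi := cont_inv Dx cD.
  refine (cont_add (cont_mul (cont_cos cPhi) (cont_mul cp (cont_mul cp (cont_mul cchis cDi))))
    (cont_mul (cont_sin cPhi) (cont_sub (cont_add (cont_mul ch11 (cont_mul cchis cDi))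
      (cont_mul cp (cont_mul (cont_mul cchi1s (cont_mul (@cont_cst R 2 x) (@cont_id R x))) cDi)))
      (cont_mul cp (cont_mul cchis (cont_mul
        (cont_add (cont_mul (cont_mul (@cont_cst R 2 x) cp) ch11)
          (cont_mul (cont_mul (@cont_cst R 2 x) cq) ch12)) (cont_mul cDi cDi))))))).
have s_ge0 x : 0 <= s x by rewrite addr_ge0 ?sqr_ge0.
have pos x : ~~ (s x < a) -> 0 < s x by rewrite -leNgt; apply: lt_le_trans.
have dF (x : R) : is_derive x 1 F (h x).
  have [sa|/pos/main[]//] := boolP (s x < a).
  rewrite h0//; apply: near_eq_is_derive (deriv_cst 0 x).
  by apply: filterS (near0 _ sa) => u /F0 ->.
have ch : continuous h.
  move=> x; have [sa|/pos/main[]//] := boolP (s x < a).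
  apply: (@near_eq_continuous _ (fun=> 0)); last exact: cont_cst.
  by apply: filterS (near0 _ sa) => u /h0 ->.
have hL x : h x = ind L x * h x.
  have [xL|xL] := leP `|x| L; first by rewrite ind_in// mul1r.
  have sL := rho2_out y xL.
  rewrite /h /flux_deriv /amplitude_deriv chi_out; last by right.
  by rewrite chi1_out ?(mul0r,mulr0,addr0,subr0)//; right.
rewrite (Rintegral_FTC L0 ch dF hL) /F !chi_out ?(mul0r, mulr0, subr0)//; right.
  by rewrite /s sqrrN lerDl sqr_ge0.
by rewrite /s lerDl sqr_ge0.
Qed.

(** Exchanging the coordinates together with z1 and z2 turns the [x.1]-derivative terms into the
    [x.2]-derivative ones, so integration by parts is carried out in one variable only. *)
Definition swap2 (x : T2) : T2 := (x.2, x.1).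

Lemma measurable_swap2 : measurable_fun setT swap2.
Proof. exact: measurable_swap. Qed.

Lemma rho2_swap x : rho2 (swap2 x) = rho2 x.
Proof. by rewrite /rho2 addrC. Qed.

Lemma den_swap z1 z2 x : den nu t z2 z1 (swap2 x) = den nu t z1 z2 x.
Proof. by rewrite /den /grad1 /grad2 rho2_swap -!addrA [X in _ + X]addrC. Qed.

Lemma phase_swap z1 z2 x : phase z2 z1 (swap2 x) = phase z1 z2 x.
Proof. by rewrite /phase rho2_swap [z2 * _ + _]addrC. Qed.

(** Algebra from |t| = D - grad1^2 - grad2^2: the two squares cancel the cosine terms of the flux
    derivatives, and the sine terms cancel by construction. *)
Lemma cos_chi_decomposition z1 z2 x :
  cos (phase z1 z2 x) * chi (rho2 x) =
  flux_deriv z1 z2 x + flux_deriv z2 z1 (swap2 x) +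
  (cos (phase z1 z2 x) * chi (rho2 x) * (`|t| / den nu t z1 z2 x) -
   sin (phase z1 z2 x) * (amplitude_deriv z1 z2 x + amplitude_deriv z2 z1 (swap2 x))).
Proof.
have g2 : grad1 nu t z2 (swap2 x) = grad2 nu t z2 x.
  by rewrite /grad1 rho2_swap.
rewrite /flux_deriv phase_swap rho2_swap den_swap g2.
have d0 : den nu t z1 z2 x != 0 by rewrite gt_eqF// den_gt0.
have T : `|t| = den nu t z1 z2 x - grad1 nu t z1 x ^+ 2 - grad2 nu t z2 x ^+ 2.
  by rewrite /den; ring.
rewrite T; move: (cos _) (sin _) (chi _) (grad1 _ _) (grad2 _ _) (amplitude_deriv _ _ _) (amplitude_deriv _ _ _) => *.
by field.
Qed.

Let mchi : measurable_fun setT chi.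
Proof.
apply: continuous_measurable_fun => s; exact: is_derive_continuous (dchi s).
Qed.

Let mchi1 : measurable_fun setT chi1.
Proof. exact: continuous_measurable_fun. Qed.

Let mx1 : measurable_fun setT (fun x : T2 => x.1). Proof. exact: measurable_fst. Qed.
Let mx2 : measurable_fun setT (fun x : T2 => x.2). Proof. exact: measurable_snd. Qed.

Lemma measurable_phase z1 z2 : measurable_fun setT (phase z1 z2).
Proof.
apply: measurable_funD => //; apply: measurable_funB.
  by apply: measurable_funD; exact: measurable_funM.
by apply: measurable_funM => //; exact: measurable_comp_rho2.
Qed.

Lemma measurable_cos_phase z1 z2 : measurable_fun setT (fun x => cos (phase z1 z2 x)).
Proof.
apply: measurableT_comp; last exact: measurable_phase.
by apply: continuous_measurable_fun; exact: continuous_cos.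
Qed.

Lemma measurable_sin_phase z1 z2 : measurable_fun setT (fun x => sin (phase z1 z2 x)).
Proof.
apply: measurableT_comp; last exact: measurable_phase.
by apply: continuous_measurable_fun; exact: continuous_sin.
Qed.

Let mden z1 z2 : measurable_fun setT (fun x => (den nu t z1 z2 x)^-1).
Proof.
apply: measurable_invr; first by move=> x; rewrite ltW// den_gt0.
exact: measurable_den.
Qed.

Lemma measurable_amplitude_deriv z1 z2 : measurable_fun setT (amplitude_deriv z1 z2).
Proof.
have mh11 : measurable_fun setT hess11.
  apply: measurable_funM => //; apply: measurable_funD.
    exact: measurable_comp_rho2.
  apply: measurable_funM; last exact: measurable_funX.
  by apply: measurable_funM => //; exact: measurable_comp_rho2.
have mh12 : measurable_fun setT hess12.
  apply: measurable_funM => //; apply: measurable_funM => //.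
  apply: measurable_funM => //.
  by apply: measurable_funM => //; exact: measurable_comp_rho2.
have mg1 := measurable_grad1 mnu t z1.
have mg2 := measurable_grad2 mnu t z2.
have mc := measurable_comp_rho2 mchi.
have mc1 := measurable_comp_rho2 mchi1.
apply: measurable_funB.
  apply: measurable_funD.
    by apply: measurable_funM => //; exact: measurable_funM.
  apply: measurable_funM => //; apply: measurable_funM => //.
  by apply: measurable_funM => //; exact: measurable_funM.
apply: measurable_funM => //; apply: measurable_funM => //.
apply: measurable_funM; last exact: measurable_funM.
by apply: measurable_funD; apply: measurable_funM => //; exact: measurable_funM.
Qed.

Lemma measurable_flux_deriv z1 z2 : measurable_fun setT (flux_deriv z1 z2).
Proof.
have mg1 := measurable_grad1 mnu t z1.
have mc := measurable_comp_rho2 mchi.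
apply: measurable_funD; apply: measurable_funM.
- exact: measurable_cos_phase.
- apply: measurable_funM => //; apply: measurable_funM => //.
  exact: measurable_funM.
- exact: measurable_sin_phase.
- exact: measurable_amplitude_deriv.
Qed.

Local Notation ann x := (annulus a L (rho2 x)).
Let hh := n1 + 2 * m1 * L ^+ 2.

Lemma chi_ann x : `|chi (rho2 x)| <= ann x.
Proof.
have [h|h] := pselect (a <= rho2 x <= L ^+ 2); first by rewrite annulus_in.
rewrite annulus_out// chi_out ?normr0//.
have [|ra] := ltP (rho2 x) a; first by left.
by right; rewrite leNgt; apply/negP => rL; apply: h; rewrite ra ltW.
Qed.

Lemma abs_le_annulus x : a <= rho2 x <= L ^+ 2 -> `|x.1| <= L /\ `|x.2| <= L.
Proof.
move=> /andP[_ h].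
by split; rewrite -ler_sqr ?nnegrE ?(ltW L0)// real_normK ?num_real//
  (le_trans _ h)// /rho2 ?lerDl ?lerDr sqr_ge0.
Qed.

(** The Hessian entries are at most |t| [hh] on the annulus. The term without a derivative of D
    gives 1 and the term with one gives 4, through g^2 + |g g'| <= 2 D, whence 5 [hh]. The term with
    [chi1] uses |g| / D <= 1 / (2 |t|^(1/2)) and needs no integration. *)
Lemma amplitude_deriv_le z1 z2 x : `|amplitude_deriv z1 z2 x| <=
  5 * hh * weight nu a L t z1 z2 x + k1 * L / Num.sqrt `|t| * ann x.
Proof.
have [h|h] := pselect (a <= rho2 x <= L ^+ 2); last first.
  have ho : rho2 x < a \/ L ^+ 2 <= rho2 x.
    have [|ra] := ltP (rho2 x) a; first by left.
    by right; rewrite leNgt; apply/negP => rL; apply: h; rewrite ra ltW.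
  rewrite /amplitude_deriv chi_out// chi1_out// /weight annulus_out//.
  by rewrite !(mul0r,mulr0,addr0,subr0) normr0.
have [hx1 hx2] := abs_le_annulus h.
rewrite /weight annulus_in// !mulr1.
have T0 : 0 < `|t| by rewrite normr_gt0.
set T := `|t| in T0 *.
set r := Num.sqrt T; have r2 : r ^+ 2 = T by rewrite sqr_sqrtr// ltW.
have r0 : 0 < r by rewrite sqrtr_gt0.
rewrite /amplitude_deriv.
have d0 := den_gt0 nu z1 z2 x t0.
have dE : den nu t z1 z2 x = T + grad1 nu t z1 x ^+ 2 + grad2 nu t z2 x ^+ 2 by [].
set d := den nu t z1 z2 x in d0 dE *.
set g := grad1 nu t z1 x in dE *; set g' := grad2 nu t z2 x in dE *.
have n1_ge0 : 0 <= n1 by rewrite (le_trans _ (nu_le h)).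
have m1_ge0 : 0 <= m1 by rewrite (le_trans _ (nu1_le h)).
have k1_ge0 : 0 <= k1 by rewrite (le_trans _ (chi1_le 0)).
have hh0 : 0 <= hh by apply: addr_ge0 => //; apply: mulr_ge0; [exact: mulr_ge0|exact: sqr_ge0].
have xx (u v : R) : `|u| <= L -> `|v| <= L -> `|nu1 (rho2 x) * (u * v)| <= m1 * L ^+ 2.
  by move=> uL vL; rewrite !normrM expr2 !ler_pM ?mulr_ge0// nu1_le.
have H11 : `|hess11 x| <= T * hh.
  rewrite /hess11 normrM normrN ler_wpM2l// /hh (le_trans (ler_normD _ _))//.
  rewrite lerD ?nu_le// -!mulrA normrM ger0_norm// ler_wpM2l//.
  by rewrite expr2 xx.
have H12 : `|hess12 x| <= T * hh.
  rewrite /hess12 normrM normrN ler_wpM2l// /hh.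
  rewrite (@le_trans _ _ (2 * m1 * L ^+ 2))// ?lerDr//.
  by rewrite -!mulrA normrM ger0_norm// ler_wpM2l// xx.
move: (hess11 x) (hess12 x) H11 H12 => h1 h2 H11 H12.
have gd : `|g| / d <= (2 * r)^-1.
  rewrite ler_pdivrMr// mulrC ler_pdivlMr ?mulr_gt0// dE -subr_ge0.
  rewrite (_ : _ - _ = (`|g| - r) ^+ 2 + g' ^+ 2) ?addr_ge0 ?sqr_ge0//.
  by rewrite -r2 -[g ^+ 2]real_normK ?num_real//; ring.
have sq1 : `|g| * `|g| + `|g| * `|g'| <= 2 * d.
  rewrite dE -subr_ge0 -[g ^+ 2]real_normK ?num_real// -[g' ^+ 2]real_normK ?num_real//.
  have := sqr_ge0 (`|g| - `|g'|); have := sqr_ge0 `|g|; have := sqr_ge0 `|g'|.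
  by have := ltW T0; nra.
have dV : 0 <= d^-1 by rewrite invr_ge0 ltW.
have cr : `|chi (rho2 x)| <= 1 by [].
have c1r : `|chi1 (rho2 x)| <= k1 by [].
have dN : `|d^-1| = d^-1 by rewrite ger0_norm.
have t1 : `|h1 * (chi (rho2 x) * d^-1)| <= hh * (T / d).
  rewrite !normrM dN (_ : hh * _ = (T * hh) * (1 * d^-1)); last by ring.
  by apply: ler_pM => //; [exact: mulr_ge0|exact: ler_wpM2r].
have t2 : `|g * (chi1 (rho2 x) * (2 * x.1) * d^-1)| <= k1 * L / r.
  rewrite !normrM dN [`|2|]ger0_norm//.
  rewrite (_ : `|g| * _ = (`|g| / d) * (`|chi1 (rho2 x)| * (2 * `|x.1|))); last by ring.
  rewrite (_ : k1 * L / r = (2 * r)^-1 * (k1 * (2 * L))); last by field; rewrite gt_eqF.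
  apply: ler_pM => //; first exact: mulr_ge0.
  by apply: ler_pM => //; exact: ler_wpM2l.
have t3 : `|g * (chi (rho2 x) * ((2 * g * h1 + 2 * g' * h2) * (d^-1 * d^-1)))| <=
    4 * hh * (T / d).
  have inner : `|2 * g * h1 + 2 * g' * h2| <=
      2 * `|g| * (T * hh) + 2 * `|g'| * (T * hh).
    rewrite (le_trans (ler_normD _ _))// lerD// 2!normrM [`|2|]ger0_norm//;
    by rewrite ler_wpM2l// mulr_ge0.
  rewrite normrM [`|chi _ * _|]normrM [`|_ * (d^-1 * d^-1)|]normrM [`|d^-1 * _|]normrM dN.
  apply: (@le_trans _ _ (`|g| * (1 * ((2 * `|g| * (T * hh) + 2 * `|g'| * (T * hh)) * (d^-1 * d^-1))))).
    apply: ler_wpM2l => //; apply: ler_pM => //.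
      by apply: mulr_ge0 => //; exact: mulr_ge0.
    by apply: ler_wpM2r => //; exact: mulr_ge0.
  rewrite [leLHS](_ : _ = (`|g| * `|g| + `|g| * `|g'|) * (2 * (T * hh) * (d^-1 * d^-1))); last by ring.
  apply: (@le_trans _ _ (2 * d * (2 * (T * hh) * (d^-1 * d^-1)))).
    by rewrite ler_wpM2r// !mulr_ge0// ltW.
  by rewrite le_eqVlt; apply/orP; left; apply/eqP; field; rewrite gt_eqF.
rewrite (le_trans (ler_normB _ _))//.
rewrite [leRHS](_ : _ = hh * (T / d) + k1 * L / r + 4 * hh * (T / d)); last by ring.
by rewrite lerD// (le_trans (ler_normD _ _))// lerD.
Qed.

Let haa : a <= a <= L ^+ 2. Proof. by rewrite lexx. Qed.

Let hh_ge0 : 0 <= hh.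
Proof.
have n1_ge0 : 0 <= n1 by rewrite (le_trans _ (nu_le haa)).
have m1_ge0 : 0 <= m1 by rewrite (le_trans _ (nu1_le haa)).
by apply: addr_ge0 => //; apply: mulr_ge0; [exact: mulr_ge0|exact: sqr_ge0].
Qed.

Let k1_ge0 : 0 <= k1. Proof. by rewrite (le_trans _ (chi1_le 0)). Qed.

Let r_gt0 : 0 < Num.sqrt `|t|. Proof. by rewrite sqrtr_gt0 normr_gt0. Qed.

(** A crude majorant for Fubini. Its dependence on t is harmless, as the flux terms integrate to
    exactly 0. *)
Lemma flux_deriv_box z1 z2 x y : `|flux_deriv z1 z2 (x, y)| <=
  (1 + (5 * hh + k1 * L / Num.sqrt `|t|)) * (ind L x * ind L y).
Proof.
have k0 : 0 <= k1 * L / Num.sqrt `|t|.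
  by rewrite divr_ge0 ?(ltW r_gt0)// mulr_ge0// ltW.
have h5 : 0 <= 5 * hh by rewrite mulr_ge0.
apply: (@le_trans _ _ ((1 + (5 * hh + k1 * L / Num.sqrt `|t|)) * ann (x, y))); last first.
  by rewrite ler_wpM2l ?(annulus_box a L0 (x, y))// !addr_ge0.
rewrite /flux_deriv (le_trans (ler_normD _ _))//.
rewrite [leRHS](_ : _ = ann (x, y) +
  (5 * hh + k1 * L / Num.sqrt `|t|) * ann (x, y)); last by ring.
rewrite lerD//.
  rewrite normrM -[leRHS]mul1r ler_pM//.
    by rewrite ler_norml cos_geN1 cos_le1.
  set g := grad1 nu t z1 (x, y).
  have d0 := den_gt0 nu z1 z2 (x, y) t0.
  have gd : g ^+ 2 / den nu t z1 z2 (x, y) <= 1.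
    by rewrite ler_pdivrMr// mul1r /den -/g addrAC lerDr addr_ge0// sqr_ge0.
  rewrite (_ : g * _ = (g ^+ 2 / den nu t z1 z2 (x, y)) * chi (rho2 (x, y))); last by ring.
  rewrite normrM -[leRHS]mul1r ler_pM//; last exact: chi_ann.
  by rewrite ger0_norm// divr_ge0 ?sqr_ge0// ltW.
rewrite normrM -[leRHS]mul1r ler_pM//; first by rewrite ler_norml sin_geN1 sin_le1.
rewrite (le_trans (amplitude_deriv_le _ _ _))// [leRHS]mulrDl lerD// ler_wpM2l//.
exact: weight_le1.
Qed.

Let mtot_swap z1 z2 : measurable_fun setT (fun x => flux_deriv z2 z1 (swap2 x)).
Proof. exact: (measurableT_comp (measurable_flux_deriv z2 z1) measurable_swap2). Qed.

Lemma Rintegral_flux_deriv_area z1 z2 : \int[area R]_x flux_deriv z1 z2 x = 0.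
Proof.
apply/eqP; rewrite -normr_le0 -[leRHS](mulr0 (2 * L)).
apply: (Rintegral_area2 (ltW L0) (measurable_flux_deriv z1 z2) (flux_deriv_box z1 z2)) => y.
by rewrite Rintegral_flux_deriv normr0.
Qed.

Lemma Rintegral_flux_deriv_swap z1 z2 : \int[area R]_x flux_deriv z2 z1 (swap2 x) = 0.
Proof.
apply/eqP; rewrite -normr_le0 -[leRHS](mulr0 (2 * L)).
have bx x y : `|flux_deriv z2 z1 (swap2 (x, y))| <=
    (1 + (5 * hh + k1 * L / Num.sqrt `|t|)) * (ind L x * ind L y).
  by rewrite [ind L x * _]mulrC; exact: flux_deriv_box.
apply: (Rintegral_area1 (ltW L0) (mtot_swap z1 z2) bx) => x.
by rewrite Rintegral_flux_deriv normr0.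
Qed.

(** After the flux terms drop out, the weight has coefficient 1 from the cosine term plus 5 [hh]
    from each of the two amplitude derivatives. The summand 8 k1 L^3 is twice k1 L times the area (2
    L)^2 of the square. *)
Lemma oscillatory_bound z1 z2 :
  `|\int[area R]_x (cos (phase z1 z2 x) * chi (rho2 x))| <=
  ((1 + 10 * hh) * (L ^+ 2 * (2 + 2 * pi) / (n0 * a / 4)) + 8 * k1 * L ^+ 3)
    / Num.sqrt `|t|.
Proof.
pose G x := cos (phase z1 z2 x) * chi (rho2 x) * (`|t| / den nu t z1 z2 x) -
   sin (phase z1 z2 x) * (amplitude_deriv z1 z2 x + amplitude_deriv z2 z1 (swap2 x)).
have mG : measurable_fun setT G.
  apply: measurable_funB; last first.
    apply: measurable_funM; first exact: measurable_sin_phase.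
    apply: measurable_funD; first exact: measurable_amplitude_deriv.
    exact: (measurableT_comp (measurable_amplitude_deriv z2 z1) measurable_swap2).
  apply: measurable_funM; last exact: measurable_funM.
  apply: measurable_funM; first exact: measurable_cos_phase.
  exact: measurable_comp_rho2.
set K := k1 * L / Num.sqrt `|t|.
have K0 : 0 <= K by rewrite divr_ge0 ?(ltW r_gt0)// mulr_ge0// ltW.
have weight_swap x : weight nu a L t z2 z1 (swap2 x) = weight nu a L t z1 z2 x.
  by rewrite /weight den_swap rho2_swap.
have GB x : `|G x| <= (1 + 10 * hh) * weight nu a L t z1 z2 x + 2 * K * ann x.
  rewrite (le_trans (ler_normB _ _))//.
  have G1 : `|cos (phase z1 z2 x) * chi (rho2 x) * (`|t| / den nu t z1 z2 x)| <=
      weight nu a L t z1 z2 x.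
    have d0 := den_gt0 nu z1 z2 x t0.
    have td : 0 <= `|t| / den nu t z1 z2 x by rewrite divr_ge0// ltW.
    rewrite normrM [`|_ / _|]ger0_norm// mulrC /weight ler_wpM2l//.
    rewrite normrM -[leRHS]mul1r ler_pM//; last exact: chi_ann.
    by rewrite ler_norml cos_geN1 cos_le1.
  have G2 : `|sin (phase z1 z2 x) * (amplitude_deriv z1 z2 x + amplitude_deriv z2 z1 (swap2 x))|
     <= 10 * hh * weight nu a L t z1 z2 x + 2 * K * ann x.
    rewrite normrM -[leRHS]mul1r ler_pM//.
      by rewrite ler_norml sin_geN1 sin_le1.
    have h1 := amplitude_deriv_le z1 z2 x; have h2 := amplitude_deriv_le z2 z1 (swap2 x).
    rewrite weight_swap rho2_swap in h2.
    rewrite (le_trans (ler_normD _ _))// (le_trans (lerD h1 h2))//.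
    by rewrite le_eqVlt; apply/orP; left; apply/eqP; rewrite -/K; ring.
  rewrite (le_trans (lerD G1 G2))// le_eqVlt; apply/orP; left; apply/eqP; ring.
have isub : rintegrable (area R) (weight nu a L t z1 z2).
  apply: (rintegrable_area_bounded (L := L) (M := 1)); first exact: measurable_weight.
  by move=> x y; exact: weight_box.
have mI : measurable_fun setT (fun x : T2 => ind L x.1 * ind L x.2).
  apply: measurable_funM.
    by apply: (measurableT_comp (measurable_ind L)).
  by apply: (measurableT_comp (measurable_ind L)).
have bI x y : `|ind L x * ind L y| <= 1 * (ind L x * ind L y).
  by rewrite mul1r ger0_norm// mulr_ge0// ind_ge0.
have iI : rintegrable (area R) (fun x => ind L x.1 * ind L x.2).
  exact: (rintegrable_area_bounded mI bI).
pose g x := (1 + 10 * hh) * weight nu a L t z1 z2 x + 2 * K * (ind L x.1 * ind L x.2).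
have ig : rintegrable (area R) g by apply: rintegrableD; exact: rintegrableZ.
have Gg x : `|G x| <= g x.
  rewrite (le_trans (GB x))// lerD2l; apply: ler_wpM2l.
    exact: mulr_ge0.
  exact: (annulus_box a L0 x).
have iG := le_rintegrable mG Gg ig.
have it : rintegrable (area R) (flux_deriv z1 z2).
  exact: (rintegrable_area_bounded (measurable_flux_deriv z1 z2) (flux_deriv_box z1 z2)).
have it' : rintegrable (area R) (fun x => flux_deriv z2 z1 (swap2 x)).
  apply: (rintegrable_area_bounded (L := L) (M := 1 + (5 * hh + K)) (mtot_swap z1 z2)) => x y.
  by rewrite [ind L x * _]mulrC; exact: flux_deriv_box.
have -> : \int[area R]_x (cos (phase z1 z2 x) * chi (rho2 x)) = \int[area R]_x G x.
  under eq_Rintegral do rewrite cos_chi_decomposition.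
  rewrite RintegralD//; last exact: rintegrableD.
  by rewrite RintegralD// Rintegral_flux_deriv_area Rintegral_flux_deriv_swap !add0r.
rewrite (le_trans (le_norm_Rintegral mG ig Gg))//.
rewrite RintegralD//; [|exact: rintegrableZ|exact: rintegrableZ].
rewrite !RintegralZl// [leRHS]mulrDl lerD//.
  rewrite -[leRHS]mulrA ler_wpM2l ?addr_ge0 ?mulr_ge0//.
  apply: le_trans (ler_norm _) _.
  exact: (Rintegral_weight a0 a1 L0 n00 mnu nu_ge z1 z2 t0).
have : `|\int[area R]_x (ind L x.1 * ind L x.2)| <= 2 * L * (2 * L).
  apply: (Rintegral_area1 (ltW L0) mI bI) => x /=.
  rewrite RintegralZl//; last exact: rintegrable_ind.
  have L2 : 0 <= 2 * L by rewrite mulr_ge0// ltW.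
  rewrite Rintegral_ind; last exact: ltW.
  have i1 : ind L x <= 1 by rewrite /ind indicE lern1 leq_b1.
  rewrite ger0_norm; last exact: mulr_ge0 (ind_ge0 L x) L2.
  exact: ler_piMl.
move=> h; apply: le_trans (_ : 2 * K * (2 * L * (2 * L)) <= _).
  apply: ler_wpM2l; first exact: mulr_ge0.
  exact: le_trans (ler_norm _) h.
by rewrite le_eqVlt; apply/orP; left; apply/eqP; rewrite /K; ring.
Qed.

End fixed_parameters.
End oscillatory.

(** * Cutoffs and dispersion relations *)

Section cutoffs.
Context {R : realType}.
Implicit Types s x : R.

(** The squared positive part is C^1, the regularity that a single integration by parts asks of the
    cutoff. *)
Definition possq x : R := Num.max x 0 ^+ 2.

Lemma continuous_max0 : continuous (fun x : R => Num.max x 0).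
Proof.
move=> x; apply: (@continuous_max _ _ (fun y : R => y) (fun=> 0)).
  exact: cvg_id.
exact: cvg_cst.
Qed.

Lemma deriv_possq x : is_derive x 1 possq (2 * Num.max x 0).
Proof.
have [x0|x0|->] := ltgtP x 0.
- rewrite mulr0; apply: near_eq_is_derive (deriv_cst 0 x).
  near=> y; rewrite /possq max_r ?expr0n//.
  by apply: ltW; near: y; exact: lt_nbhsl.
- have H : is_derive x 1 (fun y : R => y ^+ 2) (2 * x) by der; ring.
  apply: near_eq_is_derive H.
  near=> y; rewrite /possq max_l//.
  by apply: ltW; near: y; exact: lt_nbhsr.
(* At the corner the difference quotient of [possq] is the positive part itself, continuous with
   value 0. *)
- rewrite mulr0; apply/is_derive1_caratheodory.
  exists (fun y => Num.max y 0); split.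
  + move=> z; rewrite subr0 /possq maxxx expr0n subr0 expr2.
    by have [z0|z0] := leP z 0; rewrite ?mul0r.
  + exact: continuous_max0.
  + by rewrite maxxx.
Unshelve. all: by end_near. Qed.

Lemma possq_ge0 x : 0 <= possq x.
Proof. exact: sqr_ge0. Qed.

Lemma possq_out x : x <= 0 -> possq x = 0.
Proof. by move=> x0; rewrite /possq max_r// expr0n. Qed.

(** A C^1 transition from 0 on x <= 0 to 1 on x >= 1. *)
Definition step x : R := 1 - possq (1 - possq x).
Definition step' x : R := 2 * Num.max (1 - possq x) 0 * (2 * Num.max x 0).

Lemma deriv_step x : is_derive x 1 step (step' x).
Proof.
have d1 : is_derive x 1 (fun y => 1 - possq y) (0 - 2 * Num.max x 0).
  exact: deriv_sub (deriv_cst 1 x) (deriv_possq x).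
have -> : step' x =
    0 - 2 * Num.max (1 - possq x) 0 * (0 - 2 * Num.max x 0).
  by rewrite /step'; ring.
have d2 := @deriv_comp _ possq (fun y => 1 - possq y) _ _ _ (deriv_possq _) d1.
exact: (deriv_sub (deriv_cst 1 x) d2).
Qed.

Lemma step_bound x : `|step x| <= 1.
Proof.
have h1 := possq_ge0 x; have h2 := possq_ge0 (1 - possq x).
have h3 : possq (1 - possq x) <= 1.
  rewrite /possq expr_le1//; last by rewrite le_max lexx orbT.
  by rewrite ge_max ler01 andbT -/(possq x); lra.
by rewrite /step ler_norml; lra.
Qed.

Lemma step_out x : x <= 0 -> step x = 0 /\ step' x = 0.
Proof.
move=> x0; rewrite /step /step' [Num.max x 0]max_r// !mulr0 [possq x]possq_out// subr0.
by rewrite /possq max_l// expr1n subrr.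
Qed.

Lemma step_in x : 1 <= x -> step x = 1.
Proof.
move=> x1; rewrite /step possq_out ?subr0// subr_le0 /possq max_l ?exprn_ege1//.
by rewrite (le_trans _ x1).
Qed.

Lemma continuous_step' : continuous step'.
Proof.
have cp : continuous possq.
  by move=> x; exact: is_derive_continuous (deriv_possq x).
move=> x.
have c1 : {for x, continuous (fun y => Num.max (1 - possq y) 0)}.
  apply: (@cont_comp _ (fun y => Num.max y 0) (fun y => 1 - possq y)).
    exact: continuous_max0.
  exact: (cont_sub (@cont_cst R 1 x) (cp x)).
exact: (cont_mul (cont_mul (@cont_cst R 2 x) c1)
  (cont_mul (@cont_cst R 2 x) (@continuous_max0 x))).
Qed.

(** For 0 < a <= b the quadratic argument is nonpositive off (a, b) and at least 1 on [2 a, b - 1],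
    so one step function produces both flanks. *)
Definition cutoff (a b s : R) : R := step (a^-1 * ((s - a) * (b - s))).
Definition dcutoff (a b s : R) : R :=
  step' (a^-1 * ((s - a) * (b - s))) * (a^-1 * ((b - s) - (s - a))).

Lemma deriv_cutoff a b s : is_derive s 1 (cutoff a b) (dcutoff a b s).
Proof.
have dq : is_derive s 1 (fun s => a^-1 * ((s - a) * (b - s)))
    (a^-1 * ((b - s) - (s - a))) by der; ring.
exact: (@deriv_comp _ step _ _ _ _ (deriv_step _) dq).
Qed.

Lemma continuous_dcutoff a b : continuous (dcutoff a b).
Proof.
move=> s.
have dq : is_derive s 1 (fun s => a^-1 * ((s - a) * (b - s)))
    (a^-1 * ((b - s) - (s - a))) by der; ring.
have dq' : is_derive s 1 (fun s => (a^-1 * ((b - s) - (s - a)))) (a^-1 * - 2).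
  by der; ring.
have c1 := @cont_comp _ step' _ _ (@continuous_step' _) (is_derive_continuous dq).
exact: (cont_mul c1 (is_derive_continuous dq')).
Qed.

Lemma cutoff_out a b s : 0 < a -> a <= b -> s < a \/ b <= s ->
  cutoff a b s = 0 /\ dcutoff a b s = 0.
Proof.
move=> a0 ab H.
have q0 : a^-1 * ((s - a) * (b - s)) <= 0.
  rewrite pmulr_rle0 ?invr_gt0//; case: H => H.
    by rewrite mulr_le0_ge0// ?subr_le0 ?subr_ge0 ?ltW// (lt_le_trans H).
  by rewrite mulr_ge0_le0// ?subr_le0 ?subr_ge0// (le_trans ab).
have [h1 h2] := step_out q0.
by rewrite /cutoff /dcutoff h1 h2 mul0r.
Qed.

Lemma cutoff_in a b s : 0 < a -> 2 * a <= s -> s <= b - 1 -> cutoff a b s = 1.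
Proof.
move=> a0 h1 h2; apply: step_in.
rewrite ler_pdivlMl// mulr1 -[leLHS]mulr1 ler_pM//; lra.
Qed.

Lemma continuous_bounded (f : R -> R) (a b : R) : a <= b ->
  (forall s, a <= s <= b -> {for s, continuous f}) ->
  exists C : R, forall s, a <= s <= b -> `|f s| <= C.
Proof.
move=> ab cf.
have cf' : {within `[a, b], continuous (fun s => `|f s|)}.
  apply: continuous_in_subspaceT => s; rewrite inE/= in_itv/= => /cf cs.
  exact: (@continuous_comp _ _ _ f (fun x => `|x|)) cs (@norm_continuous _ _ _).
have [c _ H] := EVT_max ab cf'.
by exists `|f c| => s sab; apply: H; rewrite in_itv.
Qed.

Lemma continuous_away0 (f : R -> R) (a b : R) : a <= b ->
  (forall s, a <= s <= b -> {for s, continuous f}) ->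
  (forall s, a <= s <= b -> f s != 0) ->
  exists2 C : R, 0 < C & forall s, a <= s <= b -> C <= `|f s|.
Proof.
move=> ab cf f0.
have cf' : {within `[a, b], continuous (fun s => `|f s|)}.
  apply: continuous_in_subspaceT => s; rewrite inE/= in_itv/= => /cf cs.
  exact: (@continuous_comp _ _ _ f (fun x => `|x|)) cs (@norm_continuous _ _ _).
have [c cab H] := EVT_min ab cf'.
exists `|f c|; first by rewrite normr_gt0 f0//; move: cab; rewrite in_itv.
by move=> s sab; apply: H; rewrite in_itv.
Qed.

End cutoffs.

(** * The dispersion relations as functions of |xi|^2 *)

Section dispersion.
Context {R : realType}.
Variables (A B e : R).

Definition disp (s : R) : R :=
  (Num.sqrt (s + A ^+ 2) + e * Num.sqrt (s + B ^+ 2)) / 2.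
(** Twice the derivative of [disp], in accordance with the role of [nu] in the oscillatory
    integral. *)
Definition disp1 (s : R) : R :=
  ((Num.sqrt (s + A ^+ 2))^-1 + e * (Num.sqrt (s + B ^+ 2))^-1) / 2.
Definition disp2 (s : R) : R :=
  - ((Num.sqrt (s + A ^+ 2))^-1 ^+ 3 + e * (Num.sqrt (s + B ^+ 2))^-1 ^+ 3) / 4.

(** Positivity of s matters for C = 0, which occurs as |k| - 1 when |k| = 1. *)
Lemma deriv_sqrt_shift (C s : R) : 0 < s ->
  is_derive s 1 (fun s => Num.sqrt (s + C ^+ 2)) ((Num.sqrt (s + C ^+ 2))^-1 / 2).
Proof.
move=> s0; have sC : 0 < s + C ^+ 2 by rewrite ltr_pwDl ?sqr_ge0.
by der => //; field; rewrite gt_eqF// sqrtr_gt0.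
Qed.

Lemma deriv_inv_sqrt_shift (C s : R) : 0 < s ->
  is_derive s 1 (fun s => (Num.sqrt (s + C ^+ 2))^-1)
    (- ((Num.sqrt (s + C ^+ 2))^-1 ^+ 3) / 2).
Proof.
move=> s0; have sC : 0 < s + C ^+ 2 by rewrite ltr_pwDl ?sqr_ge0.
have q0 : Num.sqrt (s + C ^+ 2) != 0 by rewrite gt_eqF// sqrtr_gt0.
have H := @deriv_inv _ (fun s => Num.sqrt (s + C ^+ 2)) s _ q0 (deriv_sqrt_shift C s0).
by apply: deriv_eq H _; field.
Qed.

Lemma deriv_disp (s : R) : 0 < s -> is_derive s 1 disp (disp1 s / 2).
Proof.
move=> s0; have d1 := deriv_sqrt_shift A s0; have d2 := deriv_sqrt_shift B s0.
by rewrite /disp /disp1; der; field; rewrite !gt_eqF// sqrtr_gt0 ltr_pwDl ?sqr_ge0.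
Qed.

Lemma deriv_disp1 (s : R) : 0 < s -> is_derive s 1 disp1 (disp2 s).
Proof.
move=> s0; have d1 := deriv_inv_sqrt_shift A s0; have d2 := deriv_inv_sqrt_shift B s0.
by rewrite /disp1 /disp2; der; field; rewrite !gt_eqF// sqrtr_gt0 ltr_pwDl ?sqr_ge0.
Qed.

Lemma continuous_disp2 (s : R) : 0 < s -> {for s, continuous disp2}.
Proof.
move=> s0; have c1 := is_derive_continuous (deriv_inv_sqrt_shift A s0).
have c2 := is_derive_continuous (deriv_inv_sqrt_shift B s0).
refine (cont_mul (cont_opp (cont_add (cont_mul c1 (cont_mul c1 c1))
  (cont_mul (@cont_cst R e s) (cont_mul c2 (cont_mul c2 c2))))) (@cont_cst R 4^-1 s)).
Qed.

Lemma measurable_sqrt_shift (C : R) :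
  measurable_fun setT (fun s : R => Num.sqrt (s + C ^+ 2)).
Proof.
have ms : measurable_fun setT (@Num.sqrt R).
  by apply: continuous_measurable_fun; exact: sqrt_continuous.
by apply: (measurableT_comp ms); exact: measurable_funD.
Qed.

Lemma measurable_inv_sqrt_shift (C : R) :
  measurable_fun setT (fun s : R => (Num.sqrt (s + C ^+ 2))^-1).
Proof.
apply: measurable_invr; first by move=> s; exact: sqrtr_ge0.
exact: measurable_sqrt_shift.
Qed.

Lemma measurable_disp : measurable_fun setT disp.
Proof.
apply: measurable_funM => //; apply: measurable_funD.
  exact: measurable_sqrt_shift.
by apply: measurable_funM => //; exact: measurable_sqrt_shift.
Qed.

Lemma measurable_disp1 : measurable_fun setT disp1.
Proof.
apply: measurable_funM => //; apply: measurable_funD.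
  exact: measurable_inv_sqrt_shift.
by apply: measurable_funM => //; exact: measurable_inv_sqrt_shift.
Qed.

Lemma measurable_disp2 : measurable_fun setT disp2.
Proof.
apply: measurable_funM => //; apply: measurableT_comp => //.
apply: measurable_funD.
  by apply: measurable_funX; exact: measurable_inv_sqrt_shift.
apply: measurable_funM => //.
by apply: measurable_funX; exact: measurable_inv_sqrt_shift.
Qed.

End dispersion.

Section dispersion_relation.
Context {R : realType}.
Variables (k : int).
(** With |k| in place of k the shift K + 1 dominates K - 1 in modulus, so (X - Y)/2 is the
    nonnegative square root defining [lambda3]. *)
Let K : R := `|k%:~R|.

Let K0 : 0 <= K. Proof. exact: normr_ge0. Qed.

(** The discriminant factors as (b + 2 K)(b - 2 K), and the factors are r^2 + (K + 1)^2 and r^2 + (K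
    - 1)^2. *)
Lemma sqrt_discriminant (r : R) :
  let b : R := 1 + r ^+ 2 + k%:~R ^+ 2 in
  Num.sqrt (b ^+ 2 - 4 * k%:~R ^+ 2) =
  Num.sqrt (r ^+ 2 + (K + 1) ^+ 2) * Num.sqrt (r ^+ 2 + (K - 1) ^+ 2).
Proof.
move=> b; rewrite -sqrtrM ?addr_ge0 ?sqr_ge0//; congr Num.sqrt.
by rewrite /b -[k%:~R ^+ 2]real_normK ?num_real// -/K; ring.
Qed.

Lemma lambda1E (r : R) : lambda1 r k = disp (K + 1) (K - 1) 1 (r ^+ 2).
Proof.
rewrite /lambda1 sqrt_discriminant /disp mul1r.
set X := Num.sqrt (r ^+ 2 + (K + 1) ^+ 2).
set Y := Num.sqrt (r ^+ 2 + (K - 1) ^+ 2).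
have X2 : X ^+ 2 = r ^+ 2 + (K + 1) ^+ 2 by rewrite sqr_sqrtr// addr_ge0 ?sqr_ge0.
have Y2 : Y ^+ 2 = r ^+ 2 + (K - 1) ^+ 2 by rewrite sqr_sqrtr// addr_ge0 ?sqr_ge0.
have X0 : 0 <= X by exact: sqrtr_ge0.
have Y0 : 0 <= Y by exact: sqrtr_ge0.
have -> : (1 + r ^+ 2 + k%:~R ^+ 2 + X * Y) / 2 = ((X + Y) / 2) ^+ 2.
  have -> : ((X + Y) / 2) ^+ 2 = (X ^+ 2 + Y ^+ 2 + 2 * (X * Y)) / 4 by field.
  by rewrite X2 Y2 -[k%:~R ^+ 2]real_normK ?num_real// -/K; field.
by rewrite sqrtr_sqr ger0_norm// divr_ge0// addr_ge0.
Qed.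

Lemma lambda3E (r : R) : lambda3 r k = disp (K + 1) (K - 1) (-1) (r ^+ 2).
Proof.
rewrite /lambda3 sqrt_discriminant /disp mulN1r.
set X := Num.sqrt (r ^+ 2 + (K + 1) ^+ 2).
set Y := Num.sqrt (r ^+ 2 + (K - 1) ^+ 2).
have X2 : X ^+ 2 = r ^+ 2 + (K + 1) ^+ 2 by rewrite sqr_sqrtr// addr_ge0 ?sqr_ge0.
have Y2 : Y ^+ 2 = r ^+ 2 + (K - 1) ^+ 2 by rewrite sqr_sqrtr// addr_ge0 ?sqr_ge0.
have YX : Y <= X.
  rewrite ler_wsqrtr// lerD2l -subr_ge0 (_ : _ - _ = 4 * K) ?mulr_ge0//.
  by ring.
have -> : (1 + r ^+ 2 + k%:~R ^+ 2 - X * Y) / 2 = ((X - Y) / 2) ^+ 2.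
  have -> : ((X - Y) / 2) ^+ 2 = (X ^+ 2 + Y ^+ 2 - 2 * (X * Y)) / 4 by field.
  by rewrite X2 Y2 -[k%:~R ^+ 2]real_normK ?num_real// -/K; field.
by rewrite sqrtr_sqr ger0_norm// divr_ge0// subr_ge0.
Qed.

Lemma disp1_fast_neq0 (s : R) : 0 < s -> disp1 (K + 1) (K - 1) 1 s != 0.
Proof.
move=> s0; rewrite /disp1 mul1r mulf_neq0// gt_eqF// addr_gt0// invr_gt0 sqrtr_gt0.
  by rewrite ltr_pwDl ?sqr_ge0.
by rewrite ltr_pwDl ?sqr_ge0.
Qed.

(** The sign [d] separating j = 2, 4 from j = 1, 3 is kept outside [disp] so that it can be absorbed
    into the time variable without changing |t|. *)
Lemma lambda_disp (j : nat) :
  ((j = 1%N \/ j = 2%N) \/ ((j = 3%N \/ j = 4%N) /\ k <> 0)) ->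
  exists A B e d : R, [/\ d != 0, `|d| = 1,
    forall s, 0 < s -> disp1 A B e s != 0 &
    forall r, lambda j r k = d * disp A B e (r ^+ 2)].
Proof.
have one : `|1 : R| = 1 by rewrite normr1.
have none : `|-1 : R| = 1 by rewrite normrN normr1.
have n1 : (-1 : R) != 0 by rewrite oppr_eq0 oner_eq0.
case=> [[]->|[j34 k0]].
- exists (K + 1), (K - 1), 1, 1; split => //; first exact: disp1_fast_neq0.
  by move=> r; rewrite mul1r /= lambda1E.
- exists (K + 1), (K - 1), 1, (-1); split => //; first exact: disp1_fast_neq0.
  by move=> r; rewrite mulN1r /= lambda1E.
(* This is where k != 0 enters: X^2 - Y^2 = 4 K must be positive. For k = 0 the function [lambda3]
   is identically 0 and there is no dispersion. *)
have slow (s : R) : 0 < s -> disp1 (K + 1) (K - 1) (-1) s != 0.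
  move=> s0; have Kpos : 0 < K.
    by rewrite normr_gt0 intr_eq0; apply/eqP.
  rewrite /disp1 mulN1r mulf_neq0// lt_eqF// subr_lt0 ltf_pV2 ?posrE ?sqrtr_gt0.
  + rewrite ltr_sqrt; last by rewrite ltr_pwDl ?sqr_ge0.
    by rewrite ltrD2l -subr_gt0 (_ : _ - _ = 4 * K) ?mulr_gt0//; ring.
  + by rewrite ltr_pwDl ?sqr_ge0.
  + by rewrite ltr_pwDl ?sqr_ge0.
case: j34 => ->.
- exists (K + 1), (K - 1), (-1), 1; split => // r.
  by rewrite mul1r /= lambda3E.
- exists (K + 1), (K - 1), (-1), (-1); split => // r.
  by rewrite mulN1r /= lambda3E.
Qed.

End dispersion_relation.

Section kernel.
Context {R : realType}.
Local Notation T2 := (measurableTypeR R * measurableTypeR R)%type.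

(** Compactness of [a, L^2] turns the absence of critical points into the lower bound [n0], and
    continuity into the upper bounds, all independent of t and z. *)
Lemma dispersive_kernel (A B e a L : R) : 0 < a -> a <= 1 -> 0 < L ->
  a <= L ^+ 2 -> (forall s, 0 < s -> disp1 A B e s != 0) ->
  exists2 C : R, 0 <= C & forall t b z1 z2 : R, t != 0 ->
  `|\int[area R]_x (cos (z1 * x.1 + z2 * x.2 - t * disp A B e (rho2 x) + b)
     * cutoff a (L ^+ 2) (rho2 x))| <= C / Num.sqrt `|t|.
Proof.
move=> a0 a1 L0 aL nz.
have pos s : a <= s <= L ^+ 2 -> 0 < s by case/andP => h _; exact: lt_le_trans h.
have [n0 n00 Hn0] := @continuous_away0 _ (disp1 A B e) _ _ aL
  (fun s sab => is_derive_continuous (deriv_disp1 A B e (pos _ sab)))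
  (fun s sab => nz _ (pos _ sab)).
have [n1 Hn1] := @continuous_bounded _ (disp1 A B e) _ _ aL
  (fun s sab => is_derive_continuous (deriv_disp1 A B e (pos _ sab))).
have [m1 Hm1] := @continuous_bounded _ (disp2 A B e) _ _ aL
  (fun s sab => continuous_disp2 (pos _ sab)).
have [k1 Hk1] := @continuous_bounded _ (dcutoff a (L ^+ 2)) _ _ aL
  (fun s _ => @continuous_dcutoff _ a (L ^+ 2) s).
have aa : a <= a <= L ^+ 2 by rewrite lexx.
have k10 : 0 <= k1 by rewrite (le_trans _ (Hk1 _ aa)).
have out s : s < a \/ L ^+ 2 <= s -> cutoff a (L ^+ 2) s = 0 /\ dcutoff a (L ^+ 2) s = 0.
  exact: cutoff_out.
have Hk1' s : `|dcutoff a (L ^+ 2) s| <= k1.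
  have [/Hk1//|h] := pselect (a <= s <= L ^+ 2).
  have [|_ ->] := out s; last by rewrite normr0.
  have [|ra] := ltP s a; first by left.
  by right; rewrite leNgt; apply/negP => rL; apply: h; rewrite ra ltW.
eexists; last first.
  move=> t b z1 z2 t0.
  exact: (oscillatory_bound a0 a1 L0 n00 (measurable_disp A B e)
    (measurable_disp1 A B e) (measurable_disp2 A B e) aL (deriv_disp A B e)
    (deriv_disp1 A B e) (@continuous_disp2 _ A B e) Hn0 Hn1 Hm1
    (deriv_cutoff a (L ^+ 2)) (@continuous_dcutoff _ a (L ^+ 2))
    (fun s h => (out s h).1) (fun s h => (out s h).2)
    (fun s => step_bound _) Hk1' b t0 z1 z2).
have n1_ge0 : 0 <= n1 by rewrite (le_trans _ (Hn1 _ aa)).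
have m1_ge0 : 0 <= m1 by rewrite (le_trans _ (Hm1 _ aa)).
have L2 := sqr_ge0 L; have L3 : 0 <= L ^+ 3 by rewrite exprn_ge0// ltW.
have p0 := pi_ge0 R.
have hh : 0 <= n1 + 2 * m1 * L ^+ 2.
  by apply: addr_ge0 => //; apply: mulr_ge0 => //; exact: mulr_ge0.
apply: addr_ge0; apply: mulr_ge0 => //.
- by apply: addr_ge0 => //; exact: mulr_ge0.
- apply: mulr_ge0; first by apply: mulr_ge0 => //; apply: addr_ge0 => //; exact: mulr_ge0.
  by rewrite invr_ge0 divr_ge0// mulr_ge0// ltW.
- exact: mulr_ge0.
Qed.

End kernel.

(** * Multipliers *)

(** The endpoints are the minimum and maximum of the compact support; the minimum is positive
    because the support lies in (0, oo). *)
Lemma Cc_support (R : realType) (Psi : R -> R[i]) : Cc_smooth_pos Psi ->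
  exists2 r0 : R, 0 < r0 &
  exists2 r1 : R, r0 <= r1 & forall r, Psi r != 0 -> r0 <= r <= r1.
Proof.
move=> [_ _ cK posK]; set K := closure _ in cK posK.
have inK r : Psi r != 0 -> K r by move=> ?; exact: subset_closure.
have [K0|/eqP K0] := pselect (K = set0).
  (* If [Psi] is identically 0, any positive interval will do. *)
  by exists 1 => //; exists 1 => // r /inK; rewrite K0.
have /set0P Kn := K0.
have cid : {within K, continuous (fun x : R => x)}.
  by apply: continuous_subspaceT => x; exact: cvg_id.
have [c cK1 cmin] := compact_EVT_min Kn cK cid.
have [c' cK2 cmax] := compact_EVT_max Kn cK cid.
rewrite inE in cK1; exists c; first exact: posK.
exists c'; first by apply: cmin.
by move=> r /inK Kr; rewrite cmin ?cmax ?inE.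
Qed.

Section multiplier.
Context {R : realType}.
Local Notation T2 := (measurableTypeR R * measurableTypeR R)%type.
Local Notation P := (area R).

Lemma sqr_norm2 (x : R * R) : norm2 x ^+ 2 = rho2 x.
Proof. by rewrite /norm2 sqr_sqrtr// addr_ge0 ?sqr_ge0. Qed.

Lemma norm2_ge0 (x : R * R) : 0 <= norm2 x.
Proof. exact: sqrtr_ge0. Qed.

Lemma norm2_le (x : R * R) (L : R) : 0 <= L -> rho2 x <= L ^+ 2 -> norm2 x <= L.
Proof. by move=> L0; rewrite -sqr_norm2 ler_sqr// nnegrE norm2_ge0. Qed.

(** Each difference of squares factors as (eta_i - xi_i)(eta_i + xi_i), and the sums are bounded in
    terms of xi and r1. If both coordinates were closer than b, the radial difference would be at
    most d - b < d; the summand 1 in the denominator provides the strictness. *)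
Lemma rho2_separated (d r1 : R) (xi eta : R * R) : 0 < d ->
  norm2 eta <= r1 -> d <= `|rho2 eta - rho2 xi| ->
  let b := d / (`|xi.1| + `|xi.2| + 2 * r1 + 1) in
  b <= `|eta.1 - xi.1| \/ b <= `|eta.2 - xi.2|.
Proof.
move=> d0 er dd b; have [e1 e2] := norm2_le_abs eta.
have r10 : 0 <= r1 by rewrite (le_trans (norm2_ge0 eta)).
set S := `|xi.1| + `|xi.2| + 2 * r1 + 1 in b *.
have S0 : 0 < S by rewrite /S ltr_wpDl// !addr_ge0// mulr_ge0.
have [?|h1] := leP b `|eta.1 - xi.1|; first by left.
right; rewrite leNgt; apply/negP => h2.
have E : rho2 eta - rho2 xi =
    (eta.1 - xi.1) * (eta.1 + xi.1) + (eta.2 - xi.2) * (eta.2 + xi.2).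
  by rewrite /rho2; ring.
have b0 : 0 <= b by rewrite divr_ge0// ltW.
have : `|rho2 eta - rho2 xi| <= b * (S - 1).
  rewrite E (le_trans (ler_normD _ _))// !normrM.
  apply: (@le_trans _ _ (b * `|eta.1 + xi.1| + b * `|eta.2 + xi.2|)).
    by rewrite lerD// ler_wpM2r// ltW.
  rewrite -mulrDr ler_wpM2l//.
  have := ler_normD eta.1 xi.1; have := ler_normD eta.2 xi.2; rewrite /S; lra.
apply/negP; rewrite -ltNge (lt_le_trans _ dd)//.
rewrite (_ : b * (S - 1) = d - b); last by rewrite /b; field; rewrite gt_eqF.
by rewrite ltrBlDr ltrDl divr_gt0.
Qed.

Lemma dispersive_multiplier_bound (lam : R -> R) (Psi : R -> R[i])
    (A B e r0 r1 : R) :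
  0 < r0 -> r0 <= r1 -> (forall r, Psi r != 0 -> r0 <= r <= r1) ->
  (forall s, 0 < s -> disp1 A B e s != 0) ->
  (forall r, lam r = disp A B e (r ^+ 2)) ->
  exists c : R, forall (t : R) (v w u : R * R -> R[i]), t != 0 ->
    is_multiplier Psi v w -> inL 1%:E w ->
    is_multiplier (fun r => expi (- (t * lam r))) w u ->
    (cLnorm +oo u <= (c / Num.sqrt `|t|)%:E * cLnorm 1%:E w)%E.
Proof.
move=> r00 r01 Psi_supp nz lamE.
pose s0 := r0 ^+ 2; pose s1 := r1 ^+ 2.
have s00 : 0 < s0 by rewrite exprn_gt0.
have r10 : 0 < r1 by rewrite (lt_le_trans r00).
have s10 : 0 < s1 by rewrite exprn_gt0.
have s01 : s0 <= s1 by rewrite lerXn2r// nnegrE ltW.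
(* With 4 a <= s0 the cutoff rises on [a, 2 a] and a gap of at least 2 a remains below s0; the
   minimum with 1 ensures a <= 1. *)
pose a := Num.min 1 s0 / 4.
have m0 : 0 < Num.min 1 s0 by rewrite lt_min ltr01 s00.
have a0 : 0 < a by rewrite divr_gt0.
have a1 : a <= 1.
  have : Num.min 1 s0 <= 1 by rewrite ge_min lexx.
  by rewrite /a; lra.
have as0 : 4 * a <= s0.
  have : Num.min 1 s0 <= s0 by rewrite ge_min lexx orbT.
  by rewrite /a; lra.
(* Since L > 1 one has L^2 >= s1 + 2, so the cutoff is still 1 up to s1 + 1 and a gap of 1 remains
   above s1. *)
pose L := s1 + 2.
have L0 : 0 < L by rewrite /L; lra.
have LL : s1 + 2 <= L ^+ 2.
  by rewrite -/L expr2 ler_peMl ?(ltW L0)// /L; lra.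
have aL : a <= L ^+ 2 by lra.
have [C C0 kernel] := dispersive_kernel a0 a1 L0 aL nz.
pose chi s := cutoff a (L ^+ 2) s.
have mchi : measurable_fun setT chi.
  apply: continuous_measurable_fun => s.
  exact: is_derive_continuous (deriv_cutoff a (L ^+ 2) s).
pose c0 : R := (2 * pi) ^- 2.
have c00 : 0 <= c0 by rewrite invr_ge0 sqr_ge0.
exists (c0 * (4 * C)) => t v w u t0 [vhat Fv Iw] w1 [what Fw Iu].
pose g xi := Psi (norm2 xi) * vhat xi.
have g_supp eta : g eta != 0 -> r0 <= norm2 eta <= r1.
  move=> ge; apply: Psi_supp; apply: contraNN ge => /eqP Pe.
  by rewrite /g Pe mul0r.
have [g2 _ _] := Iw; have mg := g2.1.
have ig : cintegrable P g.
  by apply: (@inL2_compact_cintegrable _ _ r1 g2) => x /g_supp/andP[].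
have iw := inL1_cintegrable w1; have mw := cintegrable_cmeas iw.
have wE : {ae P, forall x, c0%:C * ft 1 g x = w x}.
  apply: (@is_inv_fourier_compact _ g g w r1 Iw mg); first exact: aeW.
  by move=> x /g_supp/andP[].
have WE := is_fourier_L1 Fw w1.
(* Where [chi] differs from 1, [rho2 xi] is at distance at least [dl] from [s0, s1], and this
   becomes a separation of [xi] from the support of [g] in one coordinate. *)
have W0 xi : chi (rho2 xi) != 1 -> ft (-1) w xi = 0.
  move=> chi1.
  have sep : rho2 xi < 2 * a \/ s1 + 1 < rho2 xi.
    have [h1|h1] := ltP (rho2 xi) (2 * a); first by left.
    right; rewrite ltNge; apply: contraNN chi1 => h2.
    by rewrite /chi cutoff_in//; lra.
  pose dl := Num.min (2 * a) 1.
  have dl0 : 0 < dl by rewrite lt_min ltr01 mulr_gt0.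
  have dl1 : dl <= 2 * a by rewrite ge_min lexx.
  have dl2 : dl <= 1 by rewrite ge_min lexx orbT.
  pose b := dl / (`|xi.1| + `|xi.2| + 2 * r1 + 1).
  apply: (@ft_ft_support _ g w c0%:C xi b) => //.
    by rewrite divr_gt0// ltr_wpDl// !addr_ge0// mulr_ge0// ltW.
  move=> eta /g_supp/andP[h0 h1]; apply: rho2_separated => //.
  have e0 : s0 <= rho2 eta.
    by rewrite -sqr_norm2 lerXn2r// ?nnegrE ?norm2_ge0// ltW.
  have e1 : rho2 eta <= s1.
    by rewrite -sqr_norm2 lerXn2r// ?nnegrE ?norm2_ge0// ltW.
  case: sep => h.
    by rewrite (le_trans _ (ler_norm _))//; lra.
  by rewrite distrC (le_trans _ (ler_norm _))//; lra.
pose m xi := expi (- (t * lam (norm2 xi))).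
have mm : cmeas m.
  apply: cmeas_expi; apply: measurableT_comp => //; apply: measurable_funM => //.
  rewrite (_ : (fun x => _) = fun x => disp A B e (rho2 x)).
    by apply: measurable_comp_rho2; exact: measurable_disp.
  by apply/funext => x; rewrite lamE sqr_norm2.
have mchi2 : cmeas (fun xi : T2 => (chi (rho2 xi))%:C).
  by apply: cmeas_real; exact: measurable_comp_rho2.
(* A representative of the symbol of [u]: by [W0] inserting [chi] changes nothing, and it supplies
   the bounded support needed to write [u] as an absolutely convergent integral. *)
pose G xi := m xi * (chi (rho2 xi))%:C * ft (-1) w xi.
have mW := cmeas_ft (-1) mw.
have mG : cmeas G by apply: cmeasM => //; exact: cmeasM.
have chi_supp xi : chi (rho2 xi) != 0 -> norm2 xi <= L.
  move=> ce; apply: norm2_le; first exact: ltW.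
  rewrite leNgt; apply: contraNN ce => h; rewrite /chi.
  by have [-> _] := cutoff_out a0 aL (or_intror (ltW h)).
have uE : {ae P, forall x, c0%:C * ft 1 G x = u x}.
  apply: (@is_inv_fourier_compact _ _ G u L Iu mG).
    apply: filterS WE => xi <-; rewrite /G.
    have [->|/W0 ->] := eqVneq (chi (rho2 xi)) 1; last by rewrite !mulr0.
    by rewrite mulr1.
  move=> xi Gx; apply: chi_supp; apply: contraNN Gx => /eqP E.
  by rewrite /G E mulr0 mul0r.
(* The direct transform of [f x] at y is (2 pi)^2 K_t(x - y), so the multiplication formula applied
   to [f x] and [w] yields the convolution. *)
pose f x xi := expi (1 * dot2 xi x) * (m xi * (chi (rho2 xi))%:C).
have mf x : cmeas (f x).
  apply: cmeasM; last exact: cmeasM.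
  by apply: cmeas_expi; apply: measurable_funM => //; exact: measurable_dot2r.
have iF x : cintegrable P (f x).
  apply: (@le_cintegrable _ _ _ P (f x) _ (mf x) _ (rintegrable_box L)) => xi.
  rewrite /f normc_expiM /m normc_expiM normcE/= expr0n addr0 sqrtr_sqr.
  have [->|/chi_supp xL] := eqVneq (chi (rho2 xi)) 0.
    by rewrite normr0 mulr_ge0// indicE.
  by rewrite norm2_box// step_bound.
have fy x y : normc (ft (-1) (f x) y) <= 2 * (C / Num.sqrt `|t|).
  have H (p : R[i] -> R) b : (forall r : R, p (expi r) = cos (r + b)) ->
      (forall z (r : R), p (z * r%:C) = p z * r) ->
      `|\int[P]_xi p (expi (-1 * dot2 xi y) * f x xi)| <= C / Num.sqrt `|t|.
    move=> pe pr.
    apply: le_trans (kernel t b (x.1 - y.1) (x.2 - y.2) t0).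
    rewrite le_eqVlt; apply/orP; left; apply/eqP; congr (`| _ |).
    apply: eq_Rintegral => xi _.
    have -> : expi (-1 * dot2 xi y) * f x xi = expi (-1 * dot2 xi y) *
        expi (1 * dot2 xi x) * m xi * (chi (rho2 xi))%:C by rewrite /f; ring.
    rewrite pr; congr (_ * _).
    have -> : expi (-1 * dot2 xi y) * expi (1 * dot2 xi x) * m xi =
        expi ((x.1 - y.1) * xi.1 + (x.2 - y.2) * xi.2 - t * disp A B e (rho2 xi)).
      have expiD (r s : R) : expi r * expi s = expi (r + s).
        apply/eqP; rewrite eq_complex/= cosD sinD eqxx/=.
        by rewrite addrC [cos r * _]mulrC [sin r * _]mulrC.
      rewrite /m !expiD; congr expi; rewrite lamE sqr_norm2 /dot2; ring.
    by rewrite pe.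
  rewrite (le_trans (normc_le_ReIm _))// mulr_natl mulr2n lerD//.
    refine (H (@complex.Re R) 0 _ _) => [r|z r]; first by rewrite addr0.
    by rewrite Re_mulc/= mulr0 subr0.
  refine (H (@complex.Im R) (- (pi / 2)) _ _) => [r|z r].
    by rewrite /= cosB cos_pihalf sin_pihalf mulr0 mulr1 add0r.
  by rewrite Im_mulc/= mulr0 add0r.
pose I := \int[P]_x normc (w x).
have I0 : 0 <= I by apply: Rintegral_ge0 => x _; exact: normc_ge0.
have CT : 0 <= C / Num.sqrt `|t| by rewrite divr_ge0// sqrtr_ge0.
have GE x : ft 1 G x = cint P (fun y => w y * ft (-1) (f x) y).
  rewrite -(ft_multiplication (-1) (iF x) iw); apply: eq_cint => xi.
  by rewrite /f /G; ring.
have bound x : normc (c0%:C * ft 1 G x) <= c0 * (4 * C) / Num.sqrt `|t| * I.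
  rewrite Normc.normcM GE.
  have -> : normc c0%:C = c0 by rewrite normcE/= expr0n addr0 sqrtr_sqr ger0_norm.
  have bnd y : normc (w y * ft (-1) (f x) y) <=
      (2 * (C / Num.sqrt `|t|)) * normc (w y).
    by rewrite Normc.normcM mulrC ler_wpM2r ?normc_ge0.
  have ib : rintegrable P (fun y => (2 * (C / Num.sqrt `|t|)) * normc (w y)).
    exact/rintegrableZ/cintegrable_normc.
  have ih : cintegrable P (fun y => w y * ft (-1) (f x) y).
    apply: (@le_cintegrable _ _ _ P _ _ _ bnd ib).
    by apply: cmeasM => //; apply: cmeas_ft; exact: mf.
  rewrite (_ : _ / _ * I = c0 * (2 * ((2 * (C / Num.sqrt `|t|)) * I))); last by ring.
  rewrite ler_wpM2l// (le_trans (normc_cint ih))// ler_wpM2l//.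
  apply: (le_trans (le_rint (cintegrable_normc ih) ib bnd)).
  by rewrite RintegralZl//; exact: cintegrable_normc.
have -> : cLnorm 1%:E w = I%:E.
  by rewrite cLnorm1E /I /Rintegral fineK// integrable_fin_num//; exact: cintegrable_normc.
rewrite -EFinM; apply: cLnormy_le.
  by rewrite mulr_ge0// divr_ge0 ?sqrtr_ge0// !mulr_ge0.
by apply: filterS uE => x <-; exact: bound.
Qed.

End multiplier.

Theorem mainTheorem2 (R : realType) (Psi : R -> R[i]) (j : nat) (k : int) :
  Cc_smooth_pos Psi ->
  ((j = 1%N \/ j = 2%N) \/ ((j = 3%N \/ j = 4%N) /\ k <> 0)) ->
  exists c : R, forall (t : R) (v Psiv u : R * R -> R[i]),
    t <> 0 ->
    inL 2%:E v ->
    is_multiplier Psi v Psiv ->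
    inL 1%:E Psiv ->
    is_multiplier (fun r => expi (- (t * lambda j r k))) Psiv u ->
    (cLnorm +oo u <= (c * `|t| `^ (- 2^-1))%:E * cLnorm 1%:E Psiv)%E.
Proof.
move=> /Cc_support[r0 r00 [r1 r01 Psi_supp]] jk.
have [A [B [e [d [d0 dn nz lE]]]]] := lambda_disp (R := R) jk.
have [c H] := @dispersive_multiplier_bound R (fun r => disp A B e (r ^+ 2)) Psi
  A B e r0 r1 r00 r01 Psi_supp nz (fun=> erefl).
exists c => t v w u /eqP t0 _ vw w1 wu.
(* The bound is applied at time t d, whose modulus is |t|. *)
have td : t * d != 0 by rewrite mulf_neq0.
have := H (t * d) v w u td vw w1.
rewrite normrM dn mulr1 powRN -powR12_sqrt//; apply.
rewrite (_ : (fun r => _) = fun r => expi (- (t * lambda j r k)))//.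
by apply/funext => r; rewrite lE mulrA.
Qed.
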